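(* Let $x>1$ be an integer. There is an integer $N$ (depending on $x$) such that for every integer $v\geq N$ with $\gcd(v,x)=\gcd(v,x+1)=1$ the following holds. Let $L$ be a multiset of size $v-1$ whose support is $\{1,2,x\}$ or $\{1,x,x+1\}$, with the possible exception of $L=\{1^a,2^b,x^c\}$ with $x$ odd and $a<3$. Then there is a realization for $L$ if and only if for every divisor $d$ of $v$ the number of multiples of $d$ in $L$ (counted with multiplicity) is at most $v-d$.
   Context: Exponents in multisets denote multiplicities, and the support of a multiset $L$ is the set of distinct elements of $L$. Let $K_v$ be the complete graph on vertex set $\{0,1,\ldots,v-1\}$. The (cyclic) length of the edge between distinct vertices $u,w$ is $\ell(u,w)=\min(|u-w|,\,v-|u-w|)$. A realization of a multiset $L$ of size $v-1$ is a Hamiltonian path in $K_v$ whose multiset of cyclic edge lengths is $L$. The Buratti-Horak-Rosa (BHR) Conjecture asserts that a multiset $L$ of size $v-1$ with support contained in $\{1,\ldots,\lfloor v/2\rfloor\}$ has a realization if and only if for every divisor $d$ of $v$ the number of multiples of $d$ in $L$ is at most $v-d$; it is said to hold for a particular support if it holds for all multisets with that support. *)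

(* Defs.v *)
From mathcomp Require Import all_boot all_order all_algebra.
From mathcomp Require Import finmap multiset.

Set Implicit Arguments.
Unset Strict Implicit.
Unset Printing Implicit Defensive.

Local Open Scope mset_scope.
Local Open Scope nat_scope.

Definition complete_graph (v : nat) : rel 'I_v := fun u w => u != w.

Definition cyclic_length (v : nat) (u w : 'I_v) : nat :=
  let d := `|u - w|%N in minn d (v - d).

Definition hamiltonian_path (T : finType) (e : rel T) (p : seq T) : bool :=
  [&& sorted e p, uniq p & [forall x, x \in p]].

Definition path_edges (T : Type) (p : seq T) : seq (T * T) := zip p (behead p).

Definition edge_lengths (v : nat) (p : seq 'I_v) : {mset nat} :=
  seq_mset [seq cyclic_length e.1 e.2 | e <- path_edges p].

Definition is_realization (v : nat) (L : {mset nat}) (p : seq 'I_v) : Prop :=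
  hamiltonian_path (@complete_graph v) p /\ edge_lengths p = L.

(* Main.v *)
Require Import Defs.
From mathcomp Require Import all_boot all_algebra.
From mathcomp Require Import finmap multiset zify ring.

(** For [v] large and coprime to [x] and [x + 1] no divisor of [v] other than 1
    divides an element of [L], so the divisor condition is automatic and a
    realization has to be built for every [L].  If 1 is frequent enough, two
    linear realizations, each using only one of the other lengths besides 1, are
    glued by an edge of length 1.  Otherwise another length [V] is frequent;
    dividing [Z/v] by [V] turns it into the step 1 and a second length [W] into
    [g = W / V].  Starting from a path made of long runs of unit steps, a Posa
    rotation at an end of the path trades exactly one unit step for a step of
    another length, and its result is again a path to which a rotation applies.
    When [W] is so frequent that rotations between two neighbouring runs do not
    suffice, one uses that [k] steps [g] amount to a bounded number of unit
    steps: the multiples [0, g, ..., (k - 1) g] cut the cycle into [k] arcs,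
    which are traversed in a zigzag, except that the first [m] elements of each
    arc are swept in rows made of steps [g].  For [{1, 2, x}] with [x] even, a
    path and its translate by [1/2] may have to be joined instead. *)

Set Implicit Arguments.
Unset Strict Implicit.
Unset Printing Implicit Defensive.
Import GRing.Theory.

Local Open Scope fset_scope.
Local Open Scope mset_scope.
Local Open Scope nat_scope.

(** * Costs of paths and rotations *)

Lemma last_rev (T : Type) (x : T) s : last x (rev s) = head x s.
Proof. by case: s => //= y s; rewrite rev_cons last_rcons. Qed.

Lemma head_rev (T : Type) (x : T) s : head x (rev s) = last x s.
Proof. by rewrite -[in RHS](revK s) last_rev. Qed.

(* The multiset of edge lengths of a path is recorded by the total cost of its
   edges for all weights of differences that are invariant under sign. *)
Definition even_weight (T : zmodType) (w : T -> nat) :=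
  forall z, w (- z)%R = w z.

Section Cost.

Variables (T : zmodType) (w : T -> nat).
Hypothesis w_opp : even_weight w.

Fixpoint cost (p : seq T) : nat :=
  if p is x :: q then (if q is y :: _ then w (x - y)%R else 0) + cost q else 0.

Lemma weight_sym x y : w (x - y)%R = w (y - x)%R.
Proof. by rewrite -w_opp opprB. Qed.

Lemma cost_cons x y p : cost (x :: y :: p) = w (x - y)%R + cost (y :: p).
Proof. by []. Qed.

Lemma cost_cat A B : A != [::] -> B != [::] ->
  cost (A ++ B) = cost A + w (last 0 A - head 0 B)%R + cost B.
Proof.
case: A => // x A _; case: B => // y B _ /=.
elim: A x => [|z A IH] x /=; first by rewrite addn0.
by rewrite IH /= !addnA.
Qed.

Lemma cost_rev p : cost (rev p) = cost p.
Proof.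
elim: p => // x p IH; rewrite rev_cons -cats1.
case: p IH => [|y p] IH //.
have yp : rev (y :: p) != [::] by rewrite -size_eq0 size_rev.
rewrite cost_cat // IH.
by rewrite last_rev /= !addn0 (weight_sym x) addnC.
Qed.

Lemma cost_rev_cat A B : A != [::] -> B != [::] ->
  cost (rev A ++ B) = cost A + w (head 0 A - head 0 B)%R + cost B.
Proof.
move=> A0 B0; rewrite cost_cat ?cost_rev ?last_rev //.
by rewrite -size_eq0 size_rev size_eq0.
Qed.

Lemma cost_map_add c p : cost [seq (c + x)%R | x <- p] = cost p.
Proof.
elim: p => // x [|y p] IH //.
by rewrite 2!map_cons !cost_cons -IH opprD addrACA subrr add0r.
Qed.

Lemma cost_map_opp c p : cost [seq (c - x)%R | x <- p] = cost p.
Proof.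
elim: p => // x [|y p] IH //.
rewrite 2!map_cons !cost_cons -IH weight_sym.
by congr (w _ + _); rewrite opprB addrC addrA subrK addrC.
Qed.

(* Locked to keep [/=] from enumerating a run. *)
Definition run (f d : T) (h : nat) : seq T :=
  locked (mkseq (fun j => f + d *+ j)%R h).

Lemma runE f d h : run f d h = mkseq (fun j => f + d *+ j)%R h.
Proof. by rewrite /run -lock. Qed.

Lemma size_run f d h : size (run f d h) = h.
Proof. by rewrite runE size_mkseq. Qed.

Lemma run_neq0 f d h : 0 < h -> run f d h != [::].
Proof. by rewrite -size_eq0 size_run; case: h. Qed.

Lemma last_run f d h : 0 < h -> last 0%R (run f d h) = (f + d *+ h.-1)%R.
Proof. by move=> h0; rewrite -nth_last size_run runE nth_mkseq // prednK. Qed.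

Lemma runS f d h : run f d h.+1 = f :: run (f + d)%R d h.
Proof.
rewrite !runE /mkseq /= mulr0n addr0 (iotaDl 1 0) -map_comp; congr (_ :: _).
by apply: eq_map => j /=; rewrite mulrS addrA.
Qed.

Lemma run0 f d : run f d 0 = [::].
Proof. by rewrite runE. Qed.

Lemma head_run f d h : 0 < h -> head 0%R (run f d h) = f.
Proof. by case: h => // h _; rewrite runS. Qed.

Lemma run_add f d h1 h2 :
  run f d (h1 + h2) = run f d h1 ++ run (f + d *+ h1)%R d h2.
Proof.
elim: h1 f => [|h1 IH] f; first by rewrite mulr0n addr0 run0.
by rewrite addSn !runS IH mulrS addrA.
Qed.

Lemma rev_run f d h : rev (run f d h) = run (f + d *+ h.-1)%R (- d)%R h.
Proof.
apply: (@eq_from_nth _ 0%R); rewrite ?size_rev ?size_run // => i Hi.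
rewrite nth_rev ?size_run // !runE !nth_mkseq //; last by lia.
rewrite -addrA mulNrn -mulrnBr; last by lia.
by congr (_ + _ *+ _)%R; lia.
Qed.

Lemma rev_runS_cat f d h p :
  rev (run f d h.+1) ++ p = rev (run (f + d)%R d h) ++ f :: p.
Proof. by rewrite runS rev_cons cat_rcons. Qed.

Lemma cost_run f d h : cost (run f d h) = h.-1 * w d.
Proof.
elim: h f => [f|[|h] IH f]; [by rewrite run0|by rewrite runS run0|].
rewrite runS [X in _ :: X]runS cost_cons -runS IH.
by rewrite opprD addrA subrr add0r w_opp mulSn.
Qed.

End Cost.

Lemma map_run (T : zmodType) (c f d : T) h :
  [seq (c + x)%R | x <- run f d h] = run (c + f)%R d h.
Proof.
by rewrite !runE -map_comp; apply: eq_map => j /=; rewrite addrA.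
Qed.

Lemma mem_run (T : zmodType) (f d : T) h j : j < h -> (f + d *+ j)%R \in run f d h.
Proof. by rewrite runE; move=> jh; apply/mapP; exists j; rewrite ?mem_iota. Qed.

(* The generalizations keep [lia]'s preprocessing out of ring-valued arguments. *)
Ltac cost_lia :=
  repeat match goal with |- context [cost ?w ?p] =>
    let c := fresh "c" in move: (cost w p) => c end;
  repeat match goal with |- context [muln ?a ?b] =>
    let c := fresh "c" in move: (muln a b) => c end;
  repeat match goal with _ : even_weight ?w |- context [?w ?x] =>
    let c := fresh "c" in move: (w x) => c end;
  lia.

Section Ladder.

Variables (T : zmodType) (d e : T).

(* One Posa rotation: the end [f] is joined to [g], and the edge from [g] to
   the next vertex [g + d] of the descending run is dropped. *)
Lemma ladder_step f g h1 h2 X Y :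
  (f - g = e \/ g - f = e)%R ->
  let p := run f d h1.+1 ++ X ++ rev (run g d h2.+2) ++ Y in
  let p' := run (g + d)%R d h2.+1 ++ rev X ++ rev (run f d h1.+1) ++ g :: Y in
  perm_eq p' p /\
  forall w : T -> nat, even_weight w ->
    cost w p' + w d = cost w p + w e.
Proof.
move=> fg p p'.
set A := run f d h1.+1 ++ X ++ rev (run (g + d)%R d h2.+1).
have Ep : p = A ++ g :: Y.
  by rewrite /p /A (runS g) rev_cons -!catA cat_rcons.
have Ep' : p' = rev A ++ g :: Y.
  by rewrite /p' /A !rev_cat revK -!catA.
have A0 : A != [::] by rewrite /A runS.
split; first by rewrite Ep Ep' perm_cat2r perm_rev.
move=> w w_opp.
rewrite Ep Ep' (cost_rev_cat w_opp A0) // (cost_cat w A0) //.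
have -> : head 0%R A = f by rewrite /A runS.
have -> : last 0%R A = (g + d)%R.
  by rewrite /A !last_cat (runS (g + d)%R) rev_cons last_rcons.
rewrite /= (addrC g) addrK.
have -> : w (f - g)%R = w e.
  by case: fg => <- //; exact: weight_sym.
lia.
Qed.

(** After a rotation the free end is [g + d], and [f + d] on the other run again differs from it by
    [e] up to sign, so rotations repeat with the two runs swapping roles; hence [odd r]. [Z]
    collects the vertices passed over; its first one, [g' - d], allows the second run to be extended
    backwards again. *)
Lemma ladder r f g h1 h2 X Y :
  (f - g = e \/ g - f = e)%R -> r < h1 -> r < h2 ->
  exists X' Z,
  let p := run f d h1 ++ X ++ rev (run g d h2) ++ Y in
  let f' := ((if odd r then g else f) + d *+ r)%R in
  let g' := ((if odd r then f else g) + d *+ r)%R in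
  let p' := run f' d ((if odd r then h2 else h1) - r) ++ X' ++
            rev (run g' d ((if odd r then h1 else h2) - r)) ++ Z ++ Y in
  [/\ perm_eq p' p,
   forall w : T -> nat, even_weight w ->
    cost w p' + r * w d = cost w p + r * w e
   & 0 < r -> exists Z', Z = (g' - d)%R :: Z'].
Proof.
elim: r f g h1 h2 X Y => [|r IH] f g h1 h2 X Y fg r1 r2.
  by exists X, [::]; rewrite /= !mulr0n !addr0 !subn0; split.
case: h1 r1 => // h1 r1; case: h2 r2 => // -[|h2] r2; first by lia.
have [pm1 c1] := ladder_step h1 h2 X Y fg.
have fg' : (g + d - (f + d) = e \/ f + d - (g + d) = e)%R.
  by case: fg => <-; [right|left]; rewrite opprD addrACA subrr addr0.
case: (posnP r) => [r0|rpos].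
  subst r; exists (rev X), [:: f; g].
  move: pm1 c1; rewrite rev_runS_cat /= !subn1 /= !mulr1n => pm1 c1.
  split=> // [w wo|_]; first by rewrite !mul1n; exact: c1.
  by exists [:: g]; rewrite addrK.
have [||X' [Z [pm c z]]] :=
  IH (g + d)%R (f + d)%R h2.+1 h1 (rev X) (f :: g :: Y) fg'; [lia|lia|].
exists X', (Z ++ [:: f; g]).
have E1 : (h2.+1 - r = h2.+2 - r.+1) by lia.
have E2 : (h1 - r = h1.+1 - r.+1) by lia.
have D x : (x + d + d *+ r = x + d *+ r.+1)%R by rewrite mulrS addrA.
move: pm c z; rewrite /= -rev_runS_cat.
case: (odd r) => /=; rewrite !D E1 E2 -!catA /= => pm c z.
- split; first exact: perm_trans pm pm1.
  + by move=> w wo; move: (c w wo) (c1 w wo); rewrite !mulSn; cost_lia.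
  + by move=> _; have [//|Z' ->] := z; exists (Z' ++ [:: f; g]).
- split; first exact: perm_trans pm pm1.
  + by move=> w wo; move: (c w wo) (c1 w wo); rewrite !mulSn; cost_lia.
  + by move=> _; have [//|Z' ->] := z; exists (Z' ++ [:: f; g]).
Qed.

End Ladder.

(** * Ladders between two runs of the cycle *)

Section Cycle.

Variable n : nat.
Notation v := n.+2.
Notation Z := 'I_n.+2.

Lemma natr_mod : (n.+2%:R = 0 :> Z)%R.
Proof. by apply: val_inj; rewrite Zp_nat /= modnn. Qed.

Lemma val_natr j : val (j%:R : Z)%R = j %% v.
Proof. by rewrite Zp_nat. Qed.

Lemma natr_sub y : y <= v -> ((v - y)%N%:R = - y%:R :> Z)%R.
Proof. by move=> yv; rewrite natrB // natr_mod sub0r. Qed.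

Definition hamiltonian (p : seq Z) := perm_eq p (run 0%R 1%R v).

Lemma perm_run (p : seq Z) l : l <= v ->
  size p = l -> (forall j, j < l -> (j%:R)%R \in p) -> perm_eq p (run 0%R 1%R l).
Proof.
move=> lv sp all_p.
have u : uniq (run (0 : Z)%R 1%R l).
  rewrite runE map_inj_in_uniq ?iota_uniq // => i j.
  rewrite !mem_iota !add0r /= => il jl /(congr1 val).
  by rewrite !val_natr !modn_small ?(leq_trans il) ?(leq_trans jl).
have sub : {subset run (0 : Z)%R 1%R l <= p}.
  move=> z; rewrite runE => /mapP [j]; rewrite mem_iota => jl ->.
  by rewrite add0r; apply: all_p.
have le : size p <= size (run (0 : Z)%R 1%R l) by rewrite sp size_run.
have [_ e_p] := uniq_min_size u sub le.
by rewrite perm_sym uniq_perm // (leq_size_uniq u sub).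
Qed.

Lemma hamiltonianP (p : seq Z) :
  size p = v -> (forall j, j < v -> (j%:R)%R \in p) -> hamiltonian p.
Proof. exact: perm_run. Qed.

(** The path [-1, -2, ..., y, 0, 1, ..., y - 1] has one edge of length [y]; then [r - 1] rotations
    descend from [-1] and [y - 1]. The two runs that remain are kept visible for later surgery. *)
Lemma single_ladder y r : 0 < y -> y < v -> 0 < r -> r <= v - y -> r <= y ->
  exists X W : seq Z, let p := run (- r%:R)%R (- 1)%R (v - y - r.-1) ++ X ++
      rev (run (y%:R - r%:R)%R (- 1)%R (y - r.-1)) ++ W in
  hamiltonian p /\
  forall w : Z -> nat, even_weight w ->
    cost w p = (v - 1 - r) * w 1%R + r * w (y%:R)%R.
Proof.
move=> y0 yv r0 rl ry.
pose A := run (-1 : Z)%R (-1)%R (v - y).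
pose B := run (y%:R - 1 : Z)%R (-1)%R y.
have vyS : v - y = (v - y).-1.+1 by lia.
have EA : rev A = run (y%:R)%R 1%R (v - y).
  rewrite rev_run opprK; congr run.
  by rewrite mulNrn -opprD -mulrS prednK ?natr_sub ?opprK //; lia.
have EB : rev B = run 0%R 1%R y.
  rewrite rev_run opprK; congr run.
  by rewrite mulNrn -addrA -opprD -mulrS prednK ?subrr.
have ham : perm_eq (A ++ [::] ++ rev B ++ [::]) (run 0%R 1%R v).
  have := run_add (0 : Z)%R 1%R y (v - y); rewrite (subnKC (ltnW yv)) => ->.
  by rewrite add0r /= cats0 -EB -EA perm_catC perm_cat2l perm_sym perm_rev.
have cst (w : Z -> nat) : even_weight w ->
  cost w (A ++ [::] ++ rev B ++ [::]) = (v - 2) * w 1%R + w (y%:R)%R.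
  move=> wo; rewrite /= cats0.
  have A0 : A != [::] by rewrite run_neq0; lia.
  have B0 : rev B != [::] by rewrite EB run_neq0.
  rewrite cost_cat //; have -> : last 0%R A = (y%:R)%R.
    by rewrite -[A]revK last_rev EA head_run //; lia.
  rewrite EB head_run // subr0 !cost_run // wo.
  have -> : v - 2 = (v - y).-1 + y.-1 by lia.
  by rewrite mulnDl; ring.
have fg : (-1 - (y%:R - 1) = y%:R :> Z \/ (y%:R - 1) - -1 = y%:R :> Z)%R.
  by right; rewrite opprK subrK.
have ED x : (x - 1 + (-1) *+ r.-1 = x - r%:R :> Z)%R.
  by rewrite mulNrn -addrA -opprD -mulrS prednK.
have ED0 : (-1 + (-1) *+ r.-1 = - r%:R :> Z)%R by have := ED 0%R; rewrite !sub0r.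
have fin X' W (C : seq Z) : perm_eq C (A ++ [::] ++ rev B ++ [::]) ->
    (forall w : Z -> nat, even_weight w -> cost w C =
       (v - 2) * w 1%R + w (y%:R)%R) ->
    perm_eq (run (- r%:R)%R (-1)%R (v - y - r.-1) ++ X' ++
       rev (run (y%:R - r%:R)%R (-1)%R (y - r.-1)) ++ W) C ->
   (forall w : Z -> nat, even_weight w ->
     cost w (run (- r%:R)%R (-1)%R (v - y - r.-1) ++ X' ++
       rev (run (y%:R - r%:R)%R (-1)%R (y - r.-1)) ++ W) +
      r.-1 * w (-1)%R = cost w C + r.-1 * w (y%:R)%R) ->
   hamiltonian (run (- r%:R)%R (-1)%R (v - y - r.-1) ++ X' ++
       rev (run (y%:R - r%:R)%R (-1)%R (y - r.-1)) ++ W) /\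
   forall w : Z -> nat, even_weight w ->
    cost w (run (- r%:R)%R (-1)%R (v - y - r.-1) ++ X' ++
       rev (run (y%:R - r%:R)%R (-1)%R (y - r.-1)) ++ W)
   = (v - 1 - r) * w 1%R + r * w (y%:R)%R.
  move=> p1 c1 p2 c2; split.
    exact: perm_trans p2 (perm_trans p1 ham).
  move=> w wo; move: (c2 w wo); rewrite (c1 w wo) wo.
  have -> : v - 2 = (v - 1 - r) + r.-1 by lia.
  have -> : r * w (y%:R)%R = w (y%:R)%R + r.-1 * w (y%:R)%R.
    by rewrite -mulSn prednK.
  rewrite mulnDl.
  move: (r.-1 * w 1%R) (r.-1 * w (y%:R)%R) ((v - 1 - r) * w 1%R) => a b c.
  cost_lia.
have r1 : r.-1 < v - y by lia.
have r2 : r.-1 < y by lia.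
have fg' : (y%:R - 1 - -1 = y%:R :> Z \/ -1 - (y%:R - 1) = y%:R :> Z)%R.
  by left; rewrite opprK subrK.
(* For odd [r - 1] the ladder starts from the reversed path, so that the free end is [- r] at either
   parity. *)
case od : (odd r.-1).
- have [X' [W]] := ladder (-1)%R [::] [::] fg' r2 r1.
  rewrite od ED0 ED !cats0 => -[p c _]; exists X', W.
  apply: (fin X' W (rev (A ++ [::] ++ rev B ++ [::]))) => //.
  + by rewrite perm_rev.
  + by move=> w wo; rewrite cost_rev // cst.
  + by rewrite /= cats0 rev_cat revK; exact: p.
  + by move=> w wo; rewrite /= cats0 rev_cat revK; exact: c.
- have [X' [W]] := ladder (-1)%R [::] [::] fg r1 r2.
  rewrite od ED0 ED !cats0 => -[p c _]; exists X', W.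
  by apply: (fin X' W (A ++ [::] ++ rev B ++ [::])); rewrite //= cats0.
Qed.

(* In the ladder between the runs [L_i = - i - 1] and [R_i = y - i - 1], the [r]
   rungs join [L_i] to [R_i], the [t] later ones [L_i] to [R_(i + o)]. *)
Lemma double_ladder y r t o : 0 < r -> r + t < v - y -> r + o + t < y ->
  y < v ->
  exists p : seq Z, hamiltonian p /\
  forall w : Z -> nat, even_weight w ->
    cost w p = (v - 1 - r - t) * w 1%R + r * w (y%:R)%R
             + t * w (y%:R - o%:R)%R.
Proof.
move=> r0 rl ro yv.
have [|||X [W [p1 c1]]] := @single_ladder y r _ yv r0; try lia.
have hE : y - r.-1 = o + (y - r.-1 - o) by lia.
have fg : (- r%:R - (y%:R - r%:R + -1 *+ o) = y%:R - o%:R :> Z \/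
           y%:R - r%:R + -1 *+ o - - r%:R = y%:R - o%:R :> Z)%R.
  by right; rewrite mulNrn; ring.
have t1 : t < v - y - r.-1 by lia.
have t2 : t < y - r.-1 - o by lia.
have [X' [W' [p2 c2 _]]] := ladder (-1)%R X
  (rev (run (y%:R - r%:R)%R (-1)%R o) ++ W) fg t1 t2.
move: p1 c1; rewrite /= hE run_add rev_cat -!catA => p1 c1.
move: p2 c2; set q := (X in perm_eq X _) => p2 c2.
exists q; split; first exact: perm_trans p2 p1.
move=> w wo; move: (c2 w wo); rewrite c1 // wo.
have -> : v - 1 - r = v - 1 - r - t + t by lia.
rewrite mulnDl addnK.
move: (_ * w 1%R) (t * w 1%R) (r * _) (t * w _) => a b c d.
cost_lia.
Qed.
End Cycle.

(** * Zigzags over many columns *)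

Section Flatten.

Variables (T : zmodType) (G : nat -> seq T).

Definition chain i k := flatten [seq G i' | i' <- iota i k].

Lemma chainS i k : chain i k.+1 = G i ++ chain i.+1 k.
Proof. by []. Qed.

Lemma chain_add i k1 k2 : chain i (k1 + k2) = chain i k1 ++ chain (i + k1) k2.
Proof. by rewrite /chain iotaD map_cat flatten_cat. Qed.

Lemma mem_chain x i i' k : i <= i' -> i' < i + k -> x \in G i' -> x \in chain i k.
Proof.
move=> i1 i2 xG; apply/flattenP; exists (G i') => //.
by apply/mapP; exists i'; rewrite // mem_iota i1.
Qed.

Lemma size_chain i k : size (chain i k) = \sum_(i <= j < i + k) size (G j).
Proof.
rewrite size_flatten /shape -map_comp sumnE big_map /index_iota addKn.
exact: eq_bigr.
Qed.

Variables (k : nat).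
Hypothesis G0 : forall i, i < k -> G i != [::].

Lemma head_chain i j : 0 < j -> i + j <= k -> head 0%R (chain i j) = head 0%R (G i).
Proof.
case: j => // j _ ij; rewrite chainS.
have : G i != [::] by apply: G0; lia.
by case: (G i).
Qed.

Lemma chain_neq0 i j : 0 < j -> i + j <= k -> chain i j != [::].
Proof.
case: j => // j _ ij; rewrite chainS.
have : G i != [::] by apply: G0; lia.
by case: (G i).
Qed.

Lemma last_chain i j : i + j < k -> last 0%R (chain i j.+1) = last 0%R (G (i + j)).
Proof.
move=> ij; rewrite -addn1 chain_add last_cat chainS cats0.
by case: (G _) (G0 ij).
Qed.

(** A chain of [j] pieces with [s] vertices has [s - j] edges inside the pieces and [j - 1] joins;
    the term [j * a] on the left avoids the subtraction. *)
Lemma cost_chain (w : T -> nat) (a b : nat) :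
  (forall i, i < k -> cost w (G i) = (size (G i)).-1 * a) ->
  (forall i, i.+1 < k -> w (last 0 (G i) - head 0 (G i.+1))%R = b) ->
  forall i j, 0 < j -> i + j <= k ->
  cost w (chain i j) + j * a = size (chain i j) * a + j.-1 * b.
Proof.
move=> cG join i j; elim: j i => // -[|j] IH i _ ij.
  rewrite chainS cats0 cG; last by lia.
  have : size (G i) != 0 by rewrite size_eq0 G0 //; lia.
  by case: (size _) => // s _; rewrite /= mulSn; lia.
have i0 : G i != [::] by rewrite G0 //; lia.
rewrite chainS cost_cat //; last by rewrite chain_neq0 //; lia.
rewrite head_chain //; last by lia.
rewrite join; last by lia.
have := IH i.+1 isT; rewrite size_cat cG; last by lia.
have : size (G i) != 0 by rewrite size_eq0.
case: (size (G i)) => // s _ /(_ _); rewrite /= => H.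
have {}H := H ltac:(lia).
move: H; rewrite !mulnDl !mulSn.
move: (j * a) (s * a) (size _ * a) (j * b) => x y z t.
cost_lia.
Qed.

End Flatten.

Lemma sum_rot k t (F : nat -> nat) :
  \sum_(0 <= i < k) F ((t + i) %% k) = \sum_(0 <= i < k) F i.
Proof.
elim: t => [|t IH].
  by rewrite big_nat_cond [RHS]big_nat_cond; apply: eq_bigr => i /andP [] ik _;
     rewrite add0n modn_small //; case/andP: ik.
rewrite -{}IH; case: k => [|k]; first by rewrite !big_geq.
rewrite big_nat_recr // [RHS]big_nat_recl //= addn0 addnC.
congr (_ + _); last by apply: eq_bigr => i _; rewrite addnS addSn.
by rewrite addSn -addnS modnDr.
Qed.

Lemma modn_sub k x : k <= x -> x < k + k -> x %% k = x - k.
Proof.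
by move=> kx xk; rewrite -{1}(subnK kx) modnDr modn_small // ltn_subLR.
Qed.

Section Wide.

Variables (n k kap rho M m : nat).
Notation v := n.+2.
Notation Z := 'I_n.+2.
Variable g : Z.
Hypotheses (k1 : 1 < k) (gk : (g *+ k = kap%:R)%R) (kM : k * M = v + rho * kap).
Hypotheses (rho0 : 0 < rho) (rhok : rho < k) (cop : coprime v k) (oddv : odd v).
Hypothesis (mM : m + kap < M).

Lemma mulrn_inj (x y : Z) : (x *+ k = y *+ k)%R -> x = y.
Proof.
have u : ((k%:R : 'Z_v) \is a GRing.unit)%R by rewrite unitZpE.
by rewrite -(mulr_natr x) -(mulr_natr y); apply: mulIr.
Qed.

(* Column [j] starts at [j g] and ends [ell j] unit steps later, where column
   [j + rho] (mod [k]) starts.  Legs are visited in the order of increasing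
   columns from [column 0]; the choice of [sig] ensures that no join between two
   consecutive legs leads from column [k - 1] to column 0, where the levels
   differ by [kap]. *)
Definition ell j := if j + rho < k then M else M - kap.

(** Multiplied by the unit [k], both sides become [rho * kap]; this is the purpose of the relation
    [kM]. *)
Lemma g_rho : (g *+ rho = M%:R)%R.
Proof.
apply: mulrn_inj; rewrite mulrnAC gk -!mulrnA (mulnC M) (mulnC kap) kM.
by rewrite natrD natr_mod add0r.
Qed.

Lemma next_column j : j < k ->
  (g *+ j + (ell j)%:R = g *+ ((j + rho) %% k))%R.
Proof.
move=> jk; rewrite /ell; case: ltnP => jr.
  by rewrite modn_small // mulrnDr g_rho.
rewrite modn_sub //; last by lia.
by rewrite (mulrnBr g jr) mulrnDr g_rho gk natrB ?addrA //; lia.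
Qed.

Definition sig : bool := odd (k + rho).
Definition column i := (sig + k - rho + i) %% k.
Definition exit_column i := (sig + i) %% k.

Lemma column_lt i : column i < k.
Proof. by rewrite ltn_mod; lia. Qed.

Lemma column_exit i : (column i + rho) %% k = exit_column i.
Proof.
rewrite modnDml; have -> : sig + k - rho + i + rho = sig + i + k by lia.
by rewrite modnDr.
Qed.

Lemma column_end i : (g *+ column i + (ell (column i))%:R = g *+ exit_column i)%R.
Proof. by rewrite next_column ?column_lt // column_exit. Qed.

(** The index wraps around when [i + 1 = rho - sig], and then [k + i] is odd by the choice of [sig].
    Legs with [k + i] even end at their lower end, so this serves the joins between lower ends and
    [exit_columnS] those between upper ends. *)
Lemma columnS i : i.+1 < k -> ~~ odd (k + i) -> column i.+1 = (column i).+1.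
Proof.
move=> ik od; rewrite /column.
have [lt|ge] := ltnP (sig + k - rho + i).+1 k.
  by rewrite addnS !modn_small //; lia.
have [eq|ne] := eqVneq (sig + k - rho + i).+1 k.
  by exfalso; move: od eq; rewrite /sig; case: (boolP (odd (k + rho))) => /=; lia.
by rewrite addnS !modn_sub //; lia.
Qed.

Lemma exit_columnS i : i.+1 < k -> odd (k + i) ->
  exit_column i.+1 = (exit_column i).+1.
Proof.
move=> ik od; rewrite /exit_column addnS.
have [lt|ge] := ltnP (sig + i).+1 k; first by rewrite !modn_small //; lia.
by exfalso; move: od ge; rewrite /sig; case: (boolP (odd (k + rho))) => /=; lia.
Qed.

Definition arc j := run (g *+ j + m%:R)%R 1%R (ell j - m).
Definition leg i := if odd (k + i) then arc (column i) else rev (arc (column i)).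
(** Row 0 has to start one unit above the end of the last leg, whose exit column is 0 or [k - 1]
    according to [sig]. *)
Definition row r :=
  run ((if sig then 0 else g *+ k.-1) + r%:R)%R (if sig then g else - g)%R k.
Definition turn r := if odd r then rev (row r) else row r.
Definition wide := chain leg 0 k ++ chain turn 0 m.

Lemma ell_gt j : m < ell j.
Proof. by rewrite /ell; case: ifP => _; lia. Qed.

Lemma size_leg i : size (leg i) = ell (column i) - m.
Proof. by rewrite /leg; case: ifP => _; rewrite ?size_rev size_run. Qed.

Lemma leg_neq0 i : leg i != [::].
Proof. by rewrite -size_eq0 size_leg; have := ell_gt (column i); lia. Qed.

Lemma turn_neq0 i : turn i != [::].
Proof.
by rewrite -size_eq0 /turn; case: ifP => _; rewrite ?size_rev size_run; lia.
Qed.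

Lemma head_arc j : head 0%R (arc j) = (g *+ j + m%:R)%R.
Proof. by rewrite head_run //; have := ell_gt j; lia. Qed.

Lemma last_arc i : last 0%R (arc (column i)) = (g *+ exit_column i - 1)%R.
Proof.
rewrite last_run; last by have := ell_gt (column i); lia.
rewrite -column_end -addrA -natrD -addrA; congr (_ + _)%R.
have -> : m + (ell (column i) - m).-1 = ell (column i) - 1.
  by have := ell_gt (column i); lia.
by rewrite natrB //; have := ell_gt (column i); lia.
Qed.

(** The columns have total length [(k - rho) M + rho (M - kap) = k M - rho kap = v]. *)
Lemma size_legs : size (chain leg 0 k) + k * m = v.
Proof.
rewrite size_chain add0n -[k in k * m]subn0 -sum_nat_const_nat -big_split /=.
rewrite (eq_bigr (fun i => ell (column i))) => [|i _]; last first.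
  by rewrite size_leg subnK // ltnW ?ell_gt.
rewrite (sum_rot _ _ ell).
have krho : k = (k - rho) + rho by lia.
rewrite (@big_cat_nat _ _ _ (k - rho)) //=; last by lia.
rewrite (@eq_big_nat _ _ _ _ _ _ (fun=> M)); last first.
  by move=> i ik; rewrite /ell ifT //; lia.
rewrite [X in _ + X](@eq_big_nat _ _ _ _ _ _ (fun=> M - kap)); last first.
  by move=> i ik; rewrite /ell ifF //; lia.
rewrite !sum_nat_const_nat subn0 subKn; last by lia.
have : rho * kap <= rho * M by rewrite leq_mul2l; lia.
rewrite mulnBr mulnBl kM.
have : rho * M <= k * M by rewrite leq_mul2r; lia.
by rewrite kM; lia.
Qed.

Lemma head_leg i : head 0%R (leg i) =
  (if odd (k + i) then g *+ column i + m%:R else g *+ exit_column i - 1)%R.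
Proof.
rewrite /leg; case: ifP => _; first exact: head_arc.
by rewrite head_rev last_arc.
Qed.

Lemma last_leg i : last 0%R (leg i) =
  (if odd (k + i) then g *+ exit_column i - 1 else g *+ column i + m%:R)%R.
Proof.
rewrite /leg; case: ifP => _; first exact: last_arc.
by rewrite last_rev head_arc.
Qed.

Lemma leg_join i : i.+1 < k ->
  (last 0 (leg i) - head 0 (leg i.+1) = - g)%R.
Proof.
move=> ik; rewrite last_leg head_leg addnS /=; case: ifP => od /=.
  by rewrite exit_columnS // mulrS; ring.
by rewrite columnS ?od // mulrS; ring.
Qed.

Lemma turn_join r : (last 0 (turn r) - head 0 (turn r.+1) = -1)%R.
Proof.
rewrite /turn /=; case: ifP => _ /=.
  by rewrite last_rev !head_run ?(ltnW k1) // mulrS; ring.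
by rewrite head_rev !last_run ?(ltnW k1) // (mulrS _ r); ring.
Qed.

Lemma cost_turn (w : Z -> nat) r : even_weight w ->
  cost w (turn r) = (size (turn r)).-1 * w g.
Proof.
move=> wo; rewrite /turn; case: ifP => _; rewrite ?cost_rev ?size_rev //;
by rewrite cost_run // size_run; case: ifP => _; rewrite ?wo.
Qed.

Lemma cost_leg (w : Z -> nat) i : even_weight w ->
  cost w (leg i) = (size (leg i)).-1 * w 1%R.
Proof.
move=> wo; rewrite /leg; case: ifP => _; rewrite ?cost_rev ?size_rev //;
by rewrite cost_run // size_run.
Qed.

Lemma size_turns : size (chain turn 0 m) = m * k.
Proof.
rewrite size_chain add0n (eq_bigr (fun=> k)) ?sum_nat_const_nat ?subn0 // => i _.
by rewrite /turn; case: ifP => _; rewrite ?size_rev size_run.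
Qed.

(** Walking up by unit steps from 0, one passes from the top of a column to the start of another by
    [next_column], so the columns cover the cycle. *)
Lemma column_decomposition j : exists c t,
  [/\ c < k, t < ell c & (j%:R = g *+ c + t%:R :> Z)%R].
Proof.
elim: j => [|j [c [t [ck tl e]]]].
  by exists 0, 0; split; rewrite ?addr0 //; have := ell_gt 0; lia.
have [lt|ge] := ltnP t.+1 (ell c).
  by exists c, t.+1; split; rewrite // mulrS e mulrS; ring.
exists ((c + rho) %% k), 0; split; first by rewrite ltn_mod; lia.
  by have := ell_gt ((c + rho) %% k); lia.
have -> : (j.+1%:R = g *+ c + t.+1%:R :> Z)%R by rewrite mulrS e mulrS; ring.
by rewrite addr0 -next_column //; congr (_ + _%:R)%R; lia.
Qed.

Lemma wide_hamiltonian : hamiltonian wide.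
Proof.
apply: hamiltonianP; first by rewrite size_cat size_turns mulnC size_legs.
move=> j _; have [c [t [ck tl ->]]] := column_decomposition j.
rewrite mem_cat; apply/orP.
have [tm|mt] := ltnP t m; [right|left].
  apply: (@mem_chain _ _ _ _ t) => //.
  have : (g *+ c + t%:R)%R \in row t.
    rewrite /row; case: ifP => _.
      by rewrite add0r addrC; exact: mem_run.
    have -> : (g *+ c + t%:R = g *+ k.-1 + t%:R + - g *+ (k.-1 - c))%R.
      by rewrite mulNrn mulrnBr; [ring|lia].
    by apply: mem_run; lia.
  by rewrite /turn; case: ifP => _; rewrite ?mem_rev.
(* The position of column [c] in the order of visits. *)
pose i := (c + rho + k - sig) %% k.
have ci : column i = c.
  rewrite /column modnDmr.
  have -> : sig + k - rho + (c + rho + k - sig) = c + k + k.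
    by rewrite /sig; case: odd => /=; lia.
  by rewrite !modnDr modn_small.
apply: (@mem_chain _ _ _ _ i) => //.
  by rewrite add0n ltn_mod; lia.
have : (g *+ c + t%:R)%R \in arc (column i).
  rewrite ci; have -> : (g *+ c + t%:R = g *+ c + m%:R + 1 *+ (t - m))%R.
    by rewrite -addrA -natrD subnKC.
  by apply: mem_run; lia.
by rewrite /leg; case: ifP => _; rewrite ?mem_rev.
Qed.

Lemma legs_turns_join : 0 < m ->
  (last 0 (chain leg 0 k) - head 0 (chain turn 0 m) = -1)%R.
Proof.
move=> m0.
have kS : k = k.-1.+1 by lia.
rewrite [X in chain leg 0 X]kS (last_chain (k := k)); last by lia.
  2: by move=> i _; exact: leg_neq0.
rewrite (head_chain (k := m)) //; last by move=> i _; exact: turn_neq0.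
rewrite last_leg ifT; last by lia.
rewrite /turn /= head_run ?(ltnW k1) // addr0 /exit_column add0n /sig.
case: (boolP (odd _)) => _ /=.
  by rewrite add1n prednK ?modnn ?mulr0n; [ring|lia].
by rewrite modn_small; [ring|lia].
Qed.

(** The steps [g] are the [k - 1] joins between legs and the [k - 1] steps of each of the [m] rows;
    all joins involving rows are unit steps. *)
Lemma cost_wide (w : Z -> nat) : even_weight w -> cost w wide =
  (v - 1 - k.-1 * m.+1) * w 1%R + k.-1 * m.+1 * w g.
Proof.
move=> wo.
have l0 i : i < k -> leg i != [::] by move=> _; exact: leg_neq0.
have t0 i : i < m -> turn i != [::] by move=> _; exact: turn_neq0.
have := @cost_chain _ leg k l0 w (w 1%R) (w g) (fun i _ => cost_leg i wo) _ 0 k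
  (ltnW k1) (leqnn _).
move/(_ _)=> H; have {}H := H ltac:(by move=> i ik; rewrite leg_join // wo).
have sl := size_legs.
have mkM : k * (m + kap) < k * M by rewrite ltn_pmul2l //; lia.
have rk : rho * kap <= k * kap by rewrite leq_mul2r; lia.
have sizes : size (chain leg 0 k) = v - k * m by lia.
have bound : k * m.+1 <= v.
  have : k * (m + kap).+1 <= k * M by rewrite leq_mul2l; lia.
  by rewrite mulnS mulnDr (mulnS k m); lia.
have Ek : k = k.-1.+1 by lia.
have Ek1 : k * m.+1 = k.-1 * m.+1 + m.+1 by rewrite {1}Ek mulSn addnC.
have legs : cost w (chain leg 0 k) = (v - k * m.+1) * w 1%R + k.-1 * w g.
  move: H; rewrite sizes.
  have -> : v - k * m = v - k * m.+1 + k by rewrite mulnS; lia.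
  rewrite mulnDl; move: (_ * w 1%R) (k * _) (_ * w g) => a b c.
  by move: (cost _ _) => d; lia.
case: (posnP m) => [m0|m0].
  rewrite /wide; have -> : chain turn 0 m = [::] by rewrite m0.
  rewrite cats0 legs Ek1 m0 !muln1; congr (_ * _ + _); lia.
have tj i : i.+1 < m -> w (last 0 (turn i) - head 0 (turn i.+1))%R = w 1%R.
  by move=> _; rewrite turn_join wo.
have T := @cost_chain _ turn m t0 w (w g) (w 1%R) (fun i _ => cost_turn i wo) tj
  0 m m0 (leqnn _).
have turns : cost w (chain turn 0 m) = m * k.-1 * w g + m.-1 * w 1%R.
  move: T; rewrite size_turns.
  have -> : m * k = m * k.-1 + m by rewrite {1}Ek mulnS addnC.
  rewrite mulnDl; move: (_ * w g) (m * _) (_ * w 1%R) => a b c.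
  by move: (cost _ _) => d; lia.
rewrite /wide cost_cat;
  [|exact: (chain_neq0 l0) (ltnW k1) _|exact: (chain_neq0 t0) m0 _].
rewrite legs_turns_join // wo legs turns.
have -> : v - 1 - k.-1 * m.+1 = v - k * m.+1 + m by lia.
rewrite mulnDl.
have -> : m * w 1%R = w 1%R + m.-1 * w 1%R by rewrite -mulSn prednK.
have -> : k.-1 * m.+1 * w g = k.-1 * w g + m * k.-1 * w g.
  by rewrite mulnS mulnDl (mulnC m).
by ring.
Qed.

(** The path starts at the free end [tip 0] of leg 0, and leg 1 comes back towards [tip 1]. Thus the
    first two legs have the form required by [ladder], with common direction [dir]. *)
Definition dir : Z := if odd k then 1%R else (-1)%R.
Definition tip i : Z :=
  if odd k then (g *+ column i + m%:R)%R else (g *+ exit_column i - 1)%R.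
Definition height i := ell (column i) - m.

Lemma leg0_run : leg 0 = run (tip 0) dir (height 0).
Proof.
rewrite /leg /tip /dir /height addn0; case: ifP => // _.
by rewrite rev_run -last_arc last_run //; have := ell_gt (column 0); lia.
Qed.

Lemma leg1_run : leg 1 = rev (run (tip 1) dir (height 1)).
Proof.
rewrite /leg /tip /dir /height addn1 /=; case: (odd k) => //=.
rewrite -last_arc last_run; last by have := ell_gt (column 1); lia.
by rewrite -rev_run revK.
Qed.

(** For odd [k] the tips are the lower ends in cyclically consecutive columns, and a wrap shifts the
    level by [kap]. For even [k], oddness of [v] forces [rho] to be odd, hence [sig] to be true, and
    the tips lie below the starts of columns 1 and 2. *)
Lemma tip_step : 2 < k -> exists2 off, off <= kap &
  (tip 0 + g = tip 1 + dir *+ off)%R.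
Proof.
move=> k2; rewrite /tip /dir; case: (boolP (odd k)) => od.
  rewrite /column !addn0.
  have E : sig + k - rho + 1 = (sig + k - rho).+1 by rewrite addn1.
  have [lt|ge] := ltnP (sig + k - rho).+1 k.
    exists 0; rewrite // E !modn_small //; last by lia.
    by rewrite mulrS; ring.
  have [eq|ne] := eqVneq (sig + k - rho).+1 k.
    exists kap; rewrite // E eq modnn modn_small; last by lia.
    by rewrite addrAC -mulrSr eq gk mulr0n; ring.
  have rho1 : rho = 1 /\ sig = true.
    by move: ge ne; rewrite /sig; case: (odd (k + rho)) => /=; lia.
  move: rho1 => [r1 s1]; rewrite E s1 r1.
  exists 0; rewrite // modn_sub; [|lia|lia].
  rewrite (modn_sub (x := _.+1)); [|lia|lia].
  have -> : (true + k - 1).+1 - k = (true + k - 1 - k).+1 by lia.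
  by rewrite mulrS; ring.
have s1 : sig = true.
  have : odd (k * M) = odd (v + rho * kap) by rewrite kM.
  rewrite oddD !oddM oddv (negbTE od) /= => H.
  by rewrite /sig oddD (negbTE od) /=; move: H; case: odd.
exists 0; rewrite // /exit_column s1 !modn_small //=.
by rewrite mulr2n mulr1n mulr0n; ring.
Qed.

Lemma height_ge i : M - kap - m <= height i.
Proof. by rewrite /height /ell; case: ifP => _; lia. Qed.

(** The rows account for multiples of [k - 1], and [r] rotations between legs 0 and 1 supply the
    remaining steps [g]. The [off] vertices next to [tip 1] are set aside so that every rung is
    exactly [g]. *)
Lemma wide_ladder r : 2 < k -> m + kap + kap + r < M ->
  exists off H H' X W, [/\ off <= kap, (tip 0 + g = tip 1 + dir *+ off)%R,
    M - m - kap - kap - r <= H /\ M - m - kap - kap - r <= H',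
  let F := (tip 0 + g *+ odd r + dir *+ r)%R in
  let F' := (tip 0 + g *+ ~~ odd r + dir *+ r)%R in
  let p := run F dir H ++ X ++ rev (run F' dir H') ++ W ++
           chain leg 2 (k - 2) ++ chain turn 0 m in
  hamiltonian p /\ forall w : Z -> nat, even_weight w ->
    cost w p = (v - 1 - (k.-1 * m.+1 + r)) * w 1%R + (k.-1 * m.+1 + r) * w g
  & let F' := (tip 0 + g *+ ~~ odd r + dir *+ r)%R in
    0 < r -> exists W', W = (F' - dir)%R :: W'].
Proof.
move=> k2 rM; have [off offk step] := tip_step k2.
have h0 := height_ge 0; have h1 := height_ge 1.
have fg : (tip 0 - (tip 1 + dir *+ off) = g \/ tip 1 + dir *+ off - tip 0 = g)%R.
  by right; rewrite -step addrC addKr.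
have r0 : r < height 0 by lia.
have r1 : r < height 1 - off by lia.
have [X [W [pm c z]]] := ladder dir [::]
  (rev (run (tip 1) dir off) ++ chain leg 2 (k - 2) ++ chain turn 0 m) fg r0 r1.
have E : wide = run (tip 0) dir (height 0) ++ [::] ++
  rev (run (tip 1 + dir *+ off)%R dir (height 1 - off)) ++
  rev (run (tip 1) dir off) ++ chain leg 2 (k - 2) ++ chain turn 0 m.
  rewrite cat0s (catA (rev (run (tip 1 + _)%R _ _))) -rev_cat -run_add subnKC;
    last by lia.
  rewrite -leg0_run -leg1_run /wide.
  have -> : chain leg 0 k = chain leg 0 (k - 2).+2 by congr chain; lia.
  by rewrite !chainS -!catA.
exists off, ((if odd r then height 1 - off else height 0) - r),
  ((if odd r then height 0 else height 1 - off) - r), X,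
  (W ++ rev (run (tip 1) dir off)).
have EF (b : bool) :
    ((if b then tip 1 + dir *+ off else tip 0) = tip 0 + g *+ b)%R.
  by case: b; rewrite ?mulr1n ?mulr0n ?addr0 // step.
have EF' : (if odd r then tip 0 else tip 1 + dir *+ off)%R =
    (tip 0 + g *+ ~~ odd r)%R.
  by rewrite -EF; case: odd.
rewrite -E EF EF' in pm c; rewrite EF' in z.
split=> // [||F' r_gt0]; first by split; case: odd; lia.
  2: by have [W' ->] := z r_gt0; exists (W' ++ rev (run (tip 1) dir off)).
rewrite -catA; split; first exact: perm_trans pm wide_hamiltonian.
move=> w wo; move: (c w wo); rewrite cost_wide // /dir.
have -> : w (if odd k then 1%R else (-1)%R) = w 1%R by case: ifP; rewrite ?wo.
have rb : k.-1 * m.+1 + r <= v - 1.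
  have : k * (m + kap + kap + r).+1 <= k * M by rewrite leq_mul2l; lia.
  have : rho * kap <= k * kap by rewrite leq_mul2r; lia.
  have : k = k.-1.+1 by lia.
  move: kM; case: k => // k' ->; rewrite !mulSn !mulnS !mulnDr; lia.
have -> : v - 1 - k.-1 * m.+1 = v - 1 - (k.-1 * m.+1 + r) + r by lia.
by rewrite !mulnDl; cost_lia.
Qed.

End Wide.

(** * Rotations that bring in a third length *)

Section WideLadder.

Variable n : nat.
Notation v := n.+2.
Notation Z := 'I_n.+2.

Lemma hamiltonian_ladder t (d e F u : Z) H H' X Y a c (x : Z) :
  let p := run F d H ++ X ++ rev (run u d H') ++ Y in
  hamiltonian p -> (d = 1 \/ d = -1)%R ->
  (F - u = e \/ u - F = e)%R -> t < H -> t < H' -> t <= a ->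
  (forall w : Z -> nat, even_weight w -> cost w p = a * w 1%R + c * w x) ->
  exists2 p', hamiltonian p' & forall w : Z -> nat, even_weight w ->
    cost w p' = (a - t) * w 1%R + c * w x + t * w e.
Proof.
move=> p ham d1 Fu tH tH' ta cp.
have [X' [W [pm cst _]]] := ladder d X Y Fu tH tH'.
move: pm cst; set q := (X in perm_eq X _) => pm cst.
exists q; first exact: perm_trans pm ham.
move=> w wo; move: (cst w wo); rewrite (cp w wo).
have -> : w d = w 1%R by case: d1 => ->; rewrite ?wo.
rewrite -{1}(subnK ta) mulnDl.
move: (_ * w 1%R) (t * w 1%R) (c * _) (t * _) => b1 b2 b3 b4.
by cost_lia.
Qed.

Variables (k kap rho M m r t : nat) (g : Z).
Hypotheses (k2 : 2 < k) (gk : (g *+ k = kap%:R)%R) (kM : k * M = v + rho * kap).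
Hypotheses (rho0 : 0 < rho) (rhok : rho < k) (cop : coprime v k) (oddv : odd v).
Hypotheses (r0 : 0 < r) (rtM : m + kap + kap + r + t + 2 < M).

Let c := k.-1 * m.+1 + r.

Let c_le : c + t <= v - 1.
Proof.
have : k * (m + kap + kap + r + t + 2) <= k * M by rewrite leq_mul2l; lia.
have : rho * kap <= k * kap by rewrite leq_mul2r; lia.
have : k = k.-1.+1 by lia.
move: kM k2; rewrite /c; case: k => // k' ->; rewrite !mulSn !mulnS !mulnDr; nia.
Qed.

(** The free end [F] and the facing vertex [F'] differ by [g] up to sign, so moving [F'] by one unit
    gives rungs [g - 1]. Depending on parities, the move shortens the second run by a vertex or
    extends it by the vertex [F' - dir], which is present because [r] is positive. *)
Lemma wide_diagonal : exists2 p : seq Z, hamiltonian p &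
  forall w : Z -> nat, even_weight w ->
  cost w p = (v - 1 - c - t) * w 1%R + c * w g + t * w (g - 1)%R.
Proof.
have k1 : 1 < k by lia.
have mM : m + kap < M by lia.
have rM : m + kap + kap + r < M by lia.
have [off [H [H' [X [W [_ _ [hH hH'] [ham cst] /(_ r0) [W' eW]]]]]]] :=
  wide_ladder k1 gk kM rho0 rhok cop oddv mM k2 rM.
set Y := _ ++ chain _ 0 m in ham cst.
set F := (_ + _ *+ odd r + _)%R in ham cst.
set F' := (_ + _ *+ ~~ odd r + _)%R in ham cst eW.
pose u := (if odd r then F' + 1 else F' - 1)%R.
have Fu : (F - u = g - 1 \/ u - F = g - 1)%R.
  rewrite /u /F /F'; case: (odd r) => /=; [left|right];
  by rewrite mulr1n mulr0n; ring.
have dE : (dir n k = 1 \/ dir n k = -1 :> Z)%R.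
  by rewrite /dir; case: ifP; [left|right].
have uE : (u = F' + dir n k \/ u = F' - dir n k)%R.
  rewrite /u /dir; case: (odd r); case: (odd k); rewrite ?opprK;
  by [left|right].
have tc : t <= v - 1 - c by move: c_le; lia.
case: uE => uE.
- have HE : H' = H'.-1.+1 by lia.
  move: ham cst; rewrite HE rev_runS_cat -uE => ham cst.
  by apply: (hamiltonian_ladder ham dE Fu _ _ tc cst); lia.
- move: ham cst; rewrite eW -uE /= -[F' in run F' _ H'](subrK (dir n k)) -uE.
  rewrite -rev_runS_cat => ham cst.
  by apply: (hamiltonian_ladder ham dE Fu _ _ tc cst); lia.
Qed.

Lemma chain_split (G : nat -> seq Z) i j i' : i <= i' -> i' < i + j ->
  chain G i j = chain G i (i' - i) ++ G i' ++ chain G i'.+1 (i + j - i'.+1).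
Proof.
move=> i1 i2; have -> : chain G i j = chain G i (i' - i + (i + j - i'.+1).+1).
  by congr chain; lia.
by rewrite chain_add chainS subnKC.
Qed.

(* As [2 e = g] and [k g = 2], [e] leads one level up or down in the columns
   [(k + 1) / 2] away; of the two legs reached by [e] and [- e], which are
   consecutive, exactly one runs against the free end. *)
Lemma wide_half (e : Z) : odd k -> 4 < k -> kap = 2 -> (e *+ 2 = g)%R ->
  exists2 p : seq Z, hamiltonian p &
  forall w : Z -> nat, even_weight w ->
  cost w p = (v - 1 - c - t) * w 1%R + c * w g + t * w e.
Proof.
move=> ok k4 kap2 eg.
have k1 : 1 < k by lia.
have mM : m + kap < M by lia.
have rM : m + kap + kap + r < M by lia.
have [off [H [H' [X [W [offk step [hH hH'] [ham cst] _]]]]]] :=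
  wide_ladder k1 gk kM rho0 rhok cop oddv mM k2 rM.
set F := (_ + _ *+ odd r + _)%R in ham cst.
set F' := (_ + _ *+ ~~ odd r + _)%R in ham cst.
have dE : dir n k = 1%R by rewrite /dir ok.
pose b : nat := odd r.
pose j1 := k.+1./2.
have j1k : j1 + j1 = k.+1 by rewrite addnn -[RHS]odd_double_half /= ok.
pose col := column k rho.
(* The free end lies in leg [b], [x] steps above its lower end; after an odd number of rotations
   this is leg 1, where [off] vertices were set aside. *)
pose x := r + (if odd r then off else 0).
have Fx : (F = g *+ col b + m%:R + x%:R)%R.
  rewrite /F /x /b dE; case: (odd r) => /=.
    rewrite mulr1n step dE /tip ok natrD; ring.
  by rewrite mulr0n addr0 addn0 /tip ok.
have x0 : 0 < x by rewrite /x; lia.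
have xr : x <= r + kap by rewrite /x; case: ifP; lia.
(* Doubling gives [(k + 1) g = 2 + g = 2 (e + 1)], and 2 is a unit. *)
have gj1 : (g *+ j1 = e + 1)%R.
  have inj2 (z z' : Z) : (z *+ 2 = z' *+ 2)%R -> z = z'.
    have u : ((2%:R : 'Z_v) \is a GRing.unit)%R by rewrite unitZpE // coprimen2.
    by rewrite -(mulr_natr z) -(mulr_natr z'); apply: mulIr.
  apply: inj2; rewrite -mulrnA muln2 -addnn j1k mulrS gk kap2 -eg.
  by rewrite mulrnDl.
have cb i : col (b + i) = (col b + i) %% k.
  by rewrite /col /column addnA modnDml.
have cbk : col b < k by rewrite /col /column ltn_mod; lia.
have wrap i : i <= k -> (g *+ col (b + i) = g *+ col b + g *+ i \/
    g *+ col (b + i) = g *+ col b + g *+ i - 2%:R)%R.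
  move=> ik; rewrite cb; have [lt|ge] := ltnP (col b + i) k.
    by left; rewrite modn_small // mulrnDr.
  right; rewrite modn_sub //; last by lia.
  by rewrite (mulrnBr g ge) mulrnDr gk kap2.
(* Since [k] is odd, the legs of odd index run downwards; [i] is the odd one of [b + j1] and
   [b + j1 - 1]. The level sought is [x - 1], or [x + 1] if the column index wraps, since this
   shifts levels by 2. *)
have [i [i2 ik oi [y [yx Fy]]]] : exists i, [/\ 1 < i, i < k, odd i & exists y,
    y <= x.+1 /\ (F - (g *+ col i + m%:R + y%:R) = e \/
      g *+ col i + m%:R + y%:R - F = e)%R].
  have bl : b <= 1 by rewrite /b; case: odd.
  have ym : (x.-1%:R = x%:R - 1 :> Z)%R by rewrite -subn1 natrB.
  have yp : (x.+1%:R = x%:R + 1 :> Z)%R by rewrite -natr1.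
  case o1 : (odd (b + j1)).
    exists (b + j1); split; [lia|lia|done|].
    have [E|E] := wrap j1 ltac:(lia); [exists x.-1|exists x.+1];
      (split; first by lia); right; rewrite E gj1 Fx ?ym ?yp; ring.
  exists (b + j1.-1); split; [lia|lia|lia|].
  have gj : (g *+ j1.-1 = 1 - e)%R.
    have := gj1; have {1}-> : j1 = j1.-1.+1 by lia.
    rewrite mulrS -eg => /(congr1 (fun z => z - e *+ 2)%R).
    by rewrite addrAC subrr add0r => ->; ring.
  have [E|E] := wrap j1.-1 ltac:(lia); [exists x.-1|exists x.+1];
    (split; first by lia); left; rewrite E gj Fx ?ym ?yp; ring.
have tc : t <= v - 1 - c by move: c_le; lia.
pose h := height k kap rho M m i.
have hi : M - kap - m <= h by rewrite /h /height /ell; case: ifP => _; lia.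
have legE : leg k kap rho M m g i =
    rev (run (g *+ col i + m%:R + y%:R)%R (dir n k) (h - y)) ++
    rev (run (g *+ col i + m%:R)%R 1%R y).
  rewrite dE /leg ifF; last by rewrite oddD ok oi.
  rewrite -rev_cat -run_add subnKC //; lia.
have pE : run F (dir n k) H ++ X ++ rev (run F' (dir n k) H') ++ W ++
    chain (leg k kap rho M m g) 2 (k - 2) ++ chain (turn k rho g) 0 m =
  run F (dir n k) H ++
    (X ++ rev (run F' (dir n k) H') ++ W ++
     chain (leg k kap rho M m g) 2 (i - 2)) ++
    rev (run (g *+ col i + m%:R + y%:R)%R (dir n k) (h - y)) ++
    (rev (run (g *+ col i + m%:R)%R 1%R y) ++
     chain (leg k kap rho M m g) i.+1 (2 + (k - 2) - i.+1) ++
     chain (turn k rho g) 0 m).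
  by rewrite (@chain_split _ 2 (k - 2) i) ?legE -?catA //; lia.
rewrite pE in ham cst.
by apply: (hamiltonian_ladder ham _ Fy _ _ tc cst); [left|lia|lia].
Qed.

End WideLadder.

(** * Linear realizations *)

Section Grid.

Variables (n z q b : nat) (s : bool).
Notation v := n.+2.
Notation Z := 'I_n.+2.
Hypotheses (z0 : 0 < z) (q0 : 0 < q).

(** The columns fill the interval from [b] to [b + z q - 1], one for each residue modulo [z]. The
    flag [s] reverses their order, to fit the end of the path that precedes them. *)
Definition grid_index i := if s then z.-1 - i else i.
Definition grid_column i : seq Z := run (b + grid_index i)%:R%R z%:R%R q.
Definition grid_leg i := if odd i then rev (grid_column i) else grid_column i.

Lemma size_grid_leg i : size (grid_leg i) = q.
Proof. by rewrite /grid_leg; case: ifP => _; rewrite ?size_rev size_run. Qed.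

Lemma grid_leg_neq0 i : grid_leg i != [::].
Proof. by rewrite -size_eq0 size_grid_leg; case: q q0. Qed.

Lemma grid_leg_join i : i.+1 < z ->
  (last 0 (grid_leg i) - head 0 (grid_leg i.+1) = if s then 1 else -1)%R.
Proof.
move=> iz; rewrite /grid_leg /=.
have E : ((b + grid_index i)%N%:R - (b + grid_index i.+1)%N%:R =
          if s then 1 else -1 :> Z)%R.
  rewrite !natrD /grid_index; case: s.
    have -> : z.-1 - i = (z.-1 - i.+1).+1 by lia.
    by rewrite mulrS; ring.
  by rewrite mulrS; ring.
case: (odd i) => /=; first by rewrite last_rev !head_run.
by rewrite head_rev !last_run // opprD addrACA subrr addr0.
Qed.

Lemma cost_grid (w : Z -> nat) : even_weight w ->
  cost w (chain grid_leg 0 z) = z.-1 * w 1%R + z * q.-1 * w (z%:R)%R.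
Proof.
move=> wo.
have cl i : i < z -> cost w (grid_leg i) = (size (grid_leg i)).-1 * w (z%:R)%R.
  move=> _; rewrite /grid_leg; case: ifP => _; rewrite ?cost_rev ?size_rev //;
  by rewrite cost_run // size_run.
have jn i : i.+1 < z -> w (last 0 (grid_leg i) - head 0 (grid_leg i.+1))%R = w 1%R.
  by move=> iz; rewrite grid_leg_join //; case: s; rewrite ?wo.
have := cost_chain (fun i _ => grid_leg_neq0 i) cl jn (i := 0) z0 (leqnn _).
rewrite size_chain add0n (eq_bigr (fun=> q)) => [|i _]; last exact: size_grid_leg.
rewrite sum_nat_const_nat subn0.
have -> : z * q = z * q.-1 + z by rewrite -{1}(prednK q0) mulnS addnC.
by rewrite mulnDl; cost_lia.
Qed.

Lemma head_grid : head 0%R (chain grid_leg 0 z) = (b + grid_index 0)%:R%R.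
Proof.
rewrite (head_chain (k := z)) // => [|i _]; last exact: grid_leg_neq0.
by rewrite /grid_leg head_run.
Qed.

Lemma grid_neq0 : chain grid_leg 0 z != [::].
Proof. by apply: (chain_neq0 (k := z)) => // i _; exact: grid_leg_neq0. Qed.

Lemma size_grid : size (chain grid_leg 0 z) = z * q.
Proof.
rewrite size_chain add0n (eq_bigr (fun=> q)) => [|i _]; last exact: size_grid_leg.
by rewrite sum_nat_const_nat subn0.
Qed.

Lemma mem_grid j : b <= j -> j < b + z * q -> (j%:R)%R \in chain grid_leg 0 z.
Proof.
move=> bj jq; pose u := j - b.
have uz : u %% z < z by rewrite ltn_mod.
have uq : u %/ z < q by rewrite ltn_divLR // mulnC; lia.
pose i := grid_index (u %% z).
have iE : grid_index i = u %% z by rewrite /i /grid_index; case: s; lia.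
have iz : i < z by rewrite /i /grid_index; case: s; lia.
apply: (@mem_chain _ _ _ _ i) => //.
have : (j%:R)%R \in grid_column i.
  have -> : (j%:R = (b + grid_index i)%N%:R + z%:R *+ (u %/ z) :> Z)%R.
    rewrite iE -mulrnA -natrD; congr (_%:R)%R.
    by rewrite -addnA mulnC [_ %% _ + _]addnC -divn_eq /u; lia.
  exact: mem_run.
by rewrite /grid_leg; case: ifP => _; rewrite ?mem_rev.
Qed.

End Grid.

Section Standard.

Variables (n z c l : nat).
Notation v := n.+2.
Notation Z := 'I_n.+2.
Hypotheses (z0 : 0 < z) (cl : c + 1 + z * z.-1 <= l) (lv : l <= v).

(** A unit run is followed by [r] rows of [z] consecutive numbers and then by a grid of [z] columns.
    The steps [z] are the [r] joins after the rows and the [z (q - 1)] steps inside the columns,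
    where [c = r + z (q - 1)]. *)
Lemma standard_path : exists S : seq Z,
  [/\ perm_eq S (run 0%R 1%R l), head 0%R S = 0%R &
   forall w, even_weight w ->
     cost w S = (l - 1 - c) * w 1%R + c * w (z%:R)%R].
Proof.
pose r := c %% z; pose q := (c %/ z).+1; pose N := l - z * (r + q).
have rz : r < z by rewrite ltn_mod.
have cE : c = r + z * q.-1 by rewrite /q /= mulnC addnC -divn_eq.
have zq : z * q = z * q.-1 + z by rewrite /q /= mulnS addnC.
(* As [r <= z - 1], the left side [c + r (z - 1) + z] is at most [c + 1 + z (z - 1)]. *)
have fit : z * (r + q) <= l.
  have : r * z.-1 <= z.-1 * z.-1 by rewrite leq_mul2r; lia.
  have Ez : z = z.-1.+1 by lia.
  have : z * r = r + r * z.-1 by rewrite {1}Ez mulSn mulnC.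
  have : z * z.-1 = z.-1 + z.-1 * z.-1 by rewrite {1}Ez mulSn.
  by rewrite mulnDr; lia.
have NE : l = N + z * r + z * q by rewrite /N -addnA -mulnDr subnK.
pose row i : seq Z := run (N + z * i)%:R%R 1%R z.
pose turn i := if odd i then rev (row i) else row i.
(* When [r] is odd the last row ends with its largest element, so the grid must begin with its
   largest residue. *)
pose G := chain (@grid_leg n z q (N + z * r) (odd r)) 0 z.
have st i : size (turn i) = z.
  by rewrite /turn; case: ifP => _; rewrite ?size_rev size_run.
have t0 i : i < r -> turn i != [::] by rewrite -size_eq0 st; case: z z0.
have G0 : G != [::] by apply: grid_neq0.
have headG : head 0%R G = (N + z * r + grid_index z (odd r) 0)%:R%R.
  exact: head_grid.
pose R := chain turn 0 r ++ G.
have hR : head 0%R R = (N%:R)%R.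
  rewrite /R; case: (posnP r) => [r0|r0].
    by rewrite r0 /= headG r0 muln0 !addn0.
  have := head_chain t0 (i := 0) r0 (leqnn _).
  case: (chain _ _ _) (chain_neq0 t0 (i := 0) r0 (leqnn _)) => //= x s _ ->.
  by rewrite /turn /= head_run // muln0 addn0.
have R0 : R != [::].
  by rewrite /R -size_eq0 size_cat addn_eq0 negb_and !size_eq0 G0 orbT.
exists (run 0%R 1%R N ++ R); split.
- apply: perm_run => //.
    rewrite !size_cat size_run size_grid // size_chain add0n.
    rewrite (eq_bigr (fun=> z)) // sum_nat_const_nat subn0 NE (mulnC r); lia.
  move=> j jl; rewrite !mem_cat; have [jN|Nj] := ltnP j N.
    by have := mem_run (0 : Z)%R 1%R jN; rewrite add0r => ->.
  apply/orP; right; apply/orP; have [jr|rj] := ltnP j (N + z * r); [left|right].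
    pose i := (j - N) %/ z.
    have ir : i < r by rewrite ltn_divLR // mulnC; lia.
    apply: (@mem_chain _ _ _ _ i) => //.
    have : (j%:R)%R \in row i.
      have -> : (j%:R = (N + z * i)%N%:R + 1 *+ ((j - N) %% z) :> Z)%R.
        rewrite -natrD; congr (_%:R)%R; rewrite mulnC -addnA -divn_eq; lia.
      by apply: mem_run; rewrite ltn_mod.
    by rewrite /turn; case: ifP => _; rewrite ?mem_rev.
  by apply: mem_grid => //; lia.
- case: (posnP N) => [N0|N0]; first by rewrite N0 run0 hR N0.
  by have := head_run (0 : Z)%R 1%R N0; rewrite -(prednK N0) runS.
move=> w wo.
have cR : cost w R = (r.+1 * z.-1) * w 1%R + c * w (z%:R)%R.
  have cG : cost w G = z.-1 * w 1%R + z * q.-1 * w (z%:R)%R by exact: cost_grid.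
  case: (posnP r) => [r0|r0].
    have -> : R = G by rewrite /R r0.
    by rewrite cG cE r0 mul1n.
  have tj i : i.+1 < r -> w (last 0 (turn i) - head 0 (turn i.+1))%R = w (z%:R)%R.
    move=> _; rewrite -wo; congr w; rewrite /turn /= opprB.
    have E : ((N + z * i.+1)%N%:R - (N + z * i)%N%:R = z%:R :> Z)%R.
      by rewrite mulnS !natrD; ring.
    case: (odd i) => /=; first by rewrite last_rev !head_run.
    by rewrite head_rev !last_run // opprD addrACA subrr addr0.
  have tc i : i < r -> cost w (turn i) = (size (turn i)).-1 * w 1%R.
    move=> _; rewrite /turn; case: ifP => _; rewrite ?cost_rev ?size_rev //;
    by rewrite cost_run // size_run.
  have := cost_chain t0 tc tj (i := 0) r0 (leqnn _).
  rewrite size_chain add0n (eq_bigr (fun=> z)) // sum_nat_const_nat subn0 => T.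
  rewrite /R (cost_cat w (chain_neq0 t0 (i := 0) r0 (leqnn _)) G0) cG.
  have rS : r = r.-1.+1 by lia.
  have -> : w (last 0 (chain turn 0 r) - head 0 G)%R = w (z%:R)%R.
    rewrite headG [X in chain _ 0 X]rS (last_chain t0); last by lia.
    rewrite add0n -wo opprB; congr w; rewrite /turn.
    have -> : odd r = ~~ odd r.-1 by rewrite {1}rS.
    have E : (N + z * r)%N = (N + z * r.-1 + z)%N by rewrite {1}rS mulnS; lia.
    rewrite E; case: odd => /=.
      by rewrite last_rev head_run // addn0 natrD addrC addKr.
    by rewrite last_run // /grid_index subn0 !natrD; ring.
  move: T; have -> : r * z = r * z.-1 + r by rewrite -{1}(prednK z0) mulnS addnC.
  have -> : c * w (z%:R)%R =
      r.-1 * w (z%:R)%R + w (z%:R)%R + z * q.-1 * w (z%:R)%R.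
    by rewrite {1}cE mulnDl {1}rS mulSn; cost_lia.
  by rewrite mulnDl mulSn mulnDl; cost_lia.
have lE : l - 1 - c = N + r.+1 * z.-1.
  have : z * r = r + r * z.-1 by rewrite -{1}(prednK z0) mulSn mulnC.
  by rewrite mulSn; lia.
case: (posnP N) => [N0|N0].
  by rewrite N0 run0 /= cR lE N0.
rewrite (cost_cat w (run_neq0 _ _ N0) R0) hR last_run // cR cost_run // lE.
have -> : (0 + 1 *+ N.-1 - N%:R = -1 :> Z)%R.
  by rewrite -{2}(prednK N0) mulrS; ring.
have -> : (N + r.+1 * z.-1) * w 1%R = w 1%R + N.-1 * w 1%R + r.+1 * z.-1 * w 1%R.
  by rewrite mulnDl -{1}(prednK N0) mulSn.
by rewrite wo; ring.
Qed.

End Standard.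

Section Linear.

Variable n : nat.
Notation v := n.+2.
Notation Z := 'I_n.+2.

Lemma perm_run_mem (S : seq Z) l j :
  perm_eq S (run 0%R 1%R l) -> j < l -> (j%:R)%R \in S.
Proof.
move=> pS jl; rewrite (perm_mem pS).
by have := mem_run (0 : Z)%R 1%R jl; rewrite add0r.
Qed.

(** The first [l] numbers, just enough for [b] steps [y], carry a reflected standard path that
    starts at [l - 1]; the others carry a translated one that starts at [l]. The two starts are
    joined. *)
Lemma linear_path y z a b c : 0 < y -> 0 < z ->
  y * y.-1 + z * z.-1 < a -> a + b + c = v - 1 ->
  exists2 p : seq Z, hamiltonian p & forall w, even_weight w ->
    cost w p = a * w 1%R + b * w (y%:R)%R + c * w (z%:R)%R.
Proof.
move=> y0 z0 alarge abc.
pose l := b + 1 + y * y.-1.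
have lv : l <= v by lia.
have [S1 [pS1 h1 c1]] := @standard_path n y b l y0 (leqnn _) lv.
have fit : c + 1 + z * z.-1 <= v - l by lia.
have [S2 [pS2 h2 c2]] := @standard_path n z c (v - l) z0 fit (leq_subr _ _).
have s1 : size S1 = l by rewrite (perm_size pS1) size_run.
have s2 : size S2 = v - l by rewrite (perm_size pS2) size_run.
exists (rev [seq (l.-1%:R - x)%R | x <- S1] ++ [seq (l%:R + x)%R | x <- S2]).
  apply: hamiltonianP; first by rewrite size_cat size_rev !size_map s1 s2 subnKC.
  move=> j jv; rewrite mem_cat mem_rev; apply/orP.
  have [jl|lj] := ltnP j l; [left|right].
    apply/mapP; exists ((l.-1 - j)%:R)%R; first by apply: perm_run_mem pS1 _; lia.
    by rewrite natrB; [ring|lia].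
  apply/mapP; exists ((j - l)%:R)%R; first by apply: perm_run_mem pS2 _; lia.
  by rewrite -natrD subnKC.
move=> w wo; rewrite cost_rev_cat //; last 2 first.
- by rewrite -size_eq0 size_map s1 /l; lia.
- by rewrite -size_eq0 size_map s2; lia.
rewrite cost_map_opp // cost_map_add c1 // c2 //.
have -> : (head 0 [seq l.-1%:R - x | x <- S1] - head 0 [seq l%:R + x | x <- S2]
          = -1 :> Z)%R.
  move: h1 h2 s1 s2; case: S1 {pS1 c1} => [|x S1].
    by rewrite /l /=; lia.
  case: S2 {pS2 c2} => [|x' S2]; first by rewrite /= => *; lia.
  move=> /= -> -> _ _; have lS : l = l.-1.+1 by rewrite /l; lia.
  by rewrite {2}lS mulrS; ring.
rewrite wo; have -> : a = l - 1 - b + (v - l - 1 - c) + 1 by rewrite /l; lia.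
by ring.
Qed.

(** The first run left by [single_ladder] is an interval left through its end [y]. A translated
    standard path with the same end [y] can replace it, which brings in the steps [z]. *)
Lemma single_ladder_standard y r z c : 0 < z ->
  0 < y -> y < v -> 0 < r -> r <= y -> c + z * z.-1 + y + r <= v ->
  exists2 p : seq Z, hamiltonian p & forall w, even_weight w ->
    cost w p = (v - 1 - r - c) * w 1%R + r * w (y%:R)%R + c * w (z%:R)%R.
Proof.
move=> z0 y0 yv r0 ry fit; pose l := v - y - r.-1.
have rl : r <= v - y by lia.
have [X [W [ham cst]]] := single_ladder y0 yv r0 rl ry.
have fitl : c + 1 + z * z.-1 <= l by rewrite /l; lia.
have lv : l <= v by rewrite /l; lia.
have [S [pS hS cS]] := @standard_path n z c l z0 fitl lv.
have l0 : 0 < l by rewrite /l; lia.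
have S0 : S != [::] by rewrite -size_eq0 (perm_size pS) size_run; lia.
set R := X ++ _ in ham cst.
have front : run (- r%:R : Z)%R (-1)%R l = rev (run (y%:R)%R 1%R l).
  rewrite rev_run; congr run; rewrite -natrD.
  have -> : y + l.-1 = v - r by rewrite /l; lia.
  by rewrite natr_sub //; lia.
have R0 : R != [::].
  rewrite /R -size_eq0 !size_cat size_rev size_run; lia.
exists (rev [seq (y%:R + x)%R | x <- S] ++ R).
  apply: perm_trans ham; rewrite perm_cat2r -/l front.
  rewrite (perm_trans (_ : perm_eq _ [seq (y%:R + x)%R | x <- S])) ?perm_rev //.
  rewrite perm_sym perm_rev perm_sym.
  have := perm_map (fun x : Z => y%:R + x)%R pS.
  by rewrite map_run addr0.
have hS' : head 0%R [seq (y%:R + x)%R | x <- S] = (y%:R)%R.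
  by case: (S) S0 hS => //= x S' _ ->; rewrite addr0.
have S0' : [seq (y%:R + x)%R | x <- S] != [::] by rewrite -size_eq0 size_map size_eq0.
move=> w wo; have := cst w wo.
rewrite -/l front (cost_rev_cat wo (run_neq0 _ _ l0) R0) (cost_rev_cat wo S0' R0).
rewrite hS' head_run // cost_run // cost_map_add cS //.
have -> : v - 1 - r = (v - 1 - r - c) + c by lia.
have -> : l.-1 = (l - 1 - c) + c by lia.
by rewrite addnK !mulnDl; cost_lia.
Qed.

End Linear.

(* [Q] visits [0, ..., l - 1] by a unit run followed by a zigzag of [z] columns; the
   path is the reversal of [h + Q], then 0, then [1 + Q].  As [h + h = 1], a column
   of [h + Q] differs by [h] or [- h] from one of [1 + Q] that is traversed in
   the opposite direction, so that rotations apply. *)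
Section Doubled.

Variables (n z q l rho t : nat).
Notation v := n.+2.
Notation Z := 'I_n.+2.
Hypotheses (z1 : 1 < z) (vl : v = l + l + 1) (ql : z * q < l).
Hypothesis (rtq : rho + t < q).

Let N := l - z * q.
Let h : Z := (l.+1%:R)%R.
Let legs := @grid_leg n z q N true.
Let Q := run (0 : Z)%R 1%R N ++ chain legs 0 z.

Let dbl : (h + h = 1)%R.
Proof.
rewrite /h -natrD; have -> : l.+1 + l.+1 = v + 1 by lia.
by rewrite natrD natr_mod add0r.
Qed.

Lemma doubled_path : exists2 p : seq Z, hamiltonian p & forall w, even_weight w ->
  cost w p = (2 * N + 2 * z - 3 + rho) * w 1%R +
             (2 + 2 * z * q.-1 - rho - t) * w (z%:R)%R + t.+1 * w h.
Proof.
have z0 : 0 < z by lia.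
have q0 : 0 < q by lia.
have N0 : 0 < N by rewrite /N; lia.
have NE : l = N + z * q by rewrite /N; lia.
have L0 : chain legs 0 z != [::] by apply: grid_neq0.
have sQ : size Q = l by rewrite size_cat size_run size_grid // NE.
have Q0 : Q != [::] by rewrite -size_eq0 sQ; lia.
have hQ : head 0%R Q = 0%R by rewrite /Q -(prednK N0) runS.
have mQ j : j < l -> (j%:R)%R \in Q.
  move=> jl; rewrite mem_cat; have [jN|Nj] := ltnP j N.
    by have := mem_run (0 : Z)%R 1%R jN; rewrite add0r => ->.
  by apply/orP; right; apply: mem_grid => //; rewrite -NE.
have cQ w : even_weight w -> cost w Q =
    (N.-1 + z.-1) * w 1%R + (1 + z * q.-1) * w (z%:R)%R.
  move=> wo; rewrite (cost_cat w (run_neq0 _ _ N0) L0) cost_run // cost_grid //.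
  rewrite head_grid // last_run //.
  have -> : (0 + 1 *+ N.-1 - (N + grid_index z true 0)%:R = - z%:R :> Z)%R.
    have -> : N + grid_index z true 0 = N.-1 + z by rewrite /grid_index; lia.
    by rewrite natrD; ring.
  by rewrite wo; ring.
pose p := rev [seq (h + x)%R | x <- Q] ++ 0%R :: [seq (1 + x)%R | x <- Q].
have hp : hamiltonian p.
  apply: hamiltonianP; first by rewrite size_cat size_rev /= !size_map sQ; lia.
  move=> j jv; rewrite mem_cat mem_rev inE; have [->|j0] := posnP j.
    by rewrite eqxx orbT.
  have [jl|lj] := leqP j l.
    apply/orP; right; apply/orP; right; apply/mapP; exists (j.-1%:R)%R.
      by apply: mQ; lia.
    by rewrite nat1r prednK.
  apply/orP; left; apply/mapP; exists ((j - l.+1)%:R)%R; first by apply: mQ; lia.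
  by rewrite /h -natrD subnKC.
have cp w : even_weight w -> cost w p =
   (2 * (N.-1 + z.-1) + 1) * w 1%R + (2 * (1 + z * q.-1)) * w (z%:R)%R + w h.
  move=> wo; rewrite /p cost_rev_cat //; last by rewrite -size_eq0 size_map size_eq0.
  rewrite -cat1s cost_cat //; last by rewrite -size_eq0 size_map size_eq0.
  rewrite !cost_map_add cQ //.
  case: (Q) Q0 hQ => //= x Q' _ ->.
  by rewrite !addr0 subr0 sub0r wo; ring.
(* The last column of [Q] read backwards starts at [f] with step [d]; the column before it is its
   translate by 1. *)
pose d : Z := if odd z.-1 then (z%:R)%R else (- z%:R)%R.
pose f : Z := if odd z.-1 then (N%:R)%R else (N%:R + z%:R *+ q.-1)%R.
pose Q1 := run (0 : Z)%R 1%R N ++ chain legs 0 (z - 2).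
have QE : Q = Q1 ++ run (f + 1)%R d q ++ rev (run f d q).
  rewrite /Q /Q1 -catA; congr (_ ++ _).
  have -> : chain legs 0 z = chain legs 0 (z - 2 + 2) by congr chain; lia.
  rewrite chain_add !chainS cats0 add0n; congr (_ ++ (_ ++ _)).
    rewrite /legs /grid_leg /grid_column /grid_index.
    have -> : z.-1 - (z - 2) = 1 by lia.
    have -> : odd (z - 2) = ~~ odd z.-1.
      have -> : z.-1 = (z - 2).+1 by lia.
      by rewrite /= negbK.
    rewrite /f /d natrD; case: (odd _) => //=.
    by rewrite rev_run addrAC.
  rewrite /legs /grid_leg /grid_column /grid_index.
  have -> : (z - 2).+1 = z.-1 by lia.
  rewrite subnn addn0 /f /d; case: (odd _) => //=.
  by rewrite rev_run opprK mulNrn addrK.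
have pE : p = run (h + f)%R d q ++ [::] ++ rev (run (h + (f + 1))%R d q) ++
    (rev [seq (h + x)%R | x <- Q1] ++ 0%R :: [seq (1 + x)%R | x <- Q1] ++
     run (1 + (f + 1))%R d q ++ rev (run (1 + f)%R d q)).
  rewrite /p QE !map_cat !rev_cat !map_rev !map_run revK -!catA //.
set Y := rev [seq (h + x)%R | x <- Q1] ++ _ in pE.
have wd w : even_weight w -> w d = w (z%:R)%R.
  by move=> wo; rewrite /d; case: ifP; rewrite ?wo.
(* The first [rho] rotations, between the last two columns of [h + Q], trade steps [z] for unit
   steps. *)
have fg : (h + f - (h + (f + 1)) = 1 \/ h + (f + 1) - (h + f) = 1)%R.
  by right; ring.
have rq : rho < q by lia.
have [X [W [pm1 c1 _]]] := ladder d [::] Y fg rq rq.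
rewrite -pE in pm1 c1.
set F := ((if odd rho then h + (f + 1) else h + f) + d *+ rho)%R in pm1 c1.
set F' := (_ + d *+ rho)%R in pm1 c1.
rewrite !if_same in pm1 c1.
(* The next [t] rotations go from the free end to the last column of [1 + Q]; the rungs are [h] or
   [1 - h], which is [h] again. *)
pose u := (1 + f + d *+ rho)%R.
have Fu : (F - u = h \/ u - F = h)%R.
  have hE : (h = 1 - h)%R by rewrite -[X in (X - h)%R]dbl addrK.
  rewrite /F /u; case: (odd rho); [left|right]; last rewrite [RHS]hE; ring.
have YE : Y = (rev [seq (h + x)%R | x <- Q1] ++ 0%R :: [seq (1 + x)%R | x <- Q1] ++
     run (1 + (f + 1))%R d q) ++ rev (run u d (q - rho)) ++ rev (run (1 + f)%R d rho).
  rewrite -rev_cat -run_add subnKC; last by lia.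
  by rewrite /Y -catA cat_cons -catA.
set Y1 := (X in X ++ _) in YE; clearbody Y1.
have tq : t < q - rho by lia.
have [X' [W' [pm2 c2 _]]] := ladder d
  (X ++ rev (run F' d (q - rho)) ++ W ++ Y1) (rev (run (1 + f)%R d rho)) Fu tq tq.
rewrite YE in pm1 c1; rewrite -!catA in pm1 c1 pm2 c2.
move: pm2 c2; set p2 := (X in perm_eq X _) => pm2 c2.
exists p2; first exact: perm_trans pm2 (perm_trans pm1 hp).
move=> w wo; have := c1 w wo; have := c2 w wo.
rewrite wd // (cp w wo).
have -> : 2 * N + 2 * z - 3 = 2 * (N.-1 + z.-1) + 1 by lia.
have zq : q.-1 <= z * q.-1 by rewrite leq_pmull.
have -> : 2 * (1 + z * q.-1) = (2 + 2 * z * q.-1 - rho - t) + rho + t by lia.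
by rewrite !mulnDl (mulSn t); cost_lia.
Qed.

End Doubled.

(** * Multiplying by a unit and choosing parameters *)

Section Scale.

Variable n : nat.
Notation v := n.+2.
Notation Z := 'I_n.+2.

Lemma natr_unit j : coprime v j -> (j%:R : Z)%R \is a GRing.unit.
Proof. by move=> cvj; have := unitZpE j (isT : 1 < v); rewrite cvj. Qed.

Lemma mem_hamiltonian (p : seq Z) x : hamiltonian p -> x \in p.
Proof. by move=> hp; rewrite -[x]natr_Zp; apply: perm_run_mem hp (ltn_ord x). Qed.

Lemma cost_scale (w : Z -> nat) (u : Z) p :
  cost w [seq (u * x)%R | x <- p] = cost (fun x => w (u * x)%R) p.
Proof. by elim: p => // x [|y p] IH //; rewrite 2!map_cons !cost_cons -IH mulrBr. Qed.

Lemma hamiltonian_scale (u : Z) p : u \is a GRing.unit -> hamiltonian p ->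
  hamiltonian [seq (u * x)%R | x <- p].
Proof.
move=> uu hp; apply: hamiltonianP; first by rewrite size_map (perm_size hp) size_run.
move=> j _; apply/mapP; exists (u^-1 * j%:R)%R; first exact: mem_hamiltonian.
by rewrite mulrA divrr ?mul1r.
Qed.

Definition realizes a l1 b l2 c l3 := exists2 q : seq Z, hamiltonian q &
  forall w, even_weight w -> cost w q =
    a * w (l1%:R)%R + b * w (l2%:R)%R + c * w (l3%:R)%R.

Lemma realizes_scale (u x1 x2 x3 : Z) a b c l1 l2 l3 :
  u \is a GRing.unit ->
  (u * x1 = l1%:R \/ u * x1 = - l1%:R)%R ->
  (u * x2 = l2%:R \/ u * x2 = - l2%:R)%R ->
  (u * x3 = l3%:R \/ u * x3 = - l3%:R)%R ->
  (exists2 p, hamiltonian p & forall w, even_weight w ->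
     cost w p = a * w x1 + b * w x2 + c * w x3) ->
  realizes a l1 b l2 c l3.
Proof.
move=> uu e1 e2 e3 [p hp cp]; exists [seq (u * x)%R | x <- p].
  exact: hamiltonian_scale.
move=> w wo; rewrite cost_scale cp => [|x]; last by rewrite mulrN wo.
have E x l : (u * x = l%:R \/ u * x = - l%:R)%R -> w (u * x)%R = w (l%:R)%R.
  by case=> ->; rewrite ?wo.
by rewrite (E _ _ e1) (E _ _ e2) (E _ _ e3).
Qed.

(** The representative [y] satisfies [k y = s v + kap] with [0 < s < k], where [s = 0] is excluded
    because [k] does not divide [kap]. Hence both arcs between 0 and [y] are long enough for
    ladders. *)
Lemma val_quotient k kap (g : Z) : 1 < k -> kap < v -> ~~ (k %| kap) ->
  (g *+ k = kap%:R)%R ->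
  [/\ v <= k * val g, v <= k * (v - val g) + kap, 0 < val g & val g < v].
Proof.
move=> k1 kv kk gk; set y := val g.
have yv : y < v by exact: ltn_ord.
have : (k * y) %% v = kap.
  rewrite -[RHS](modn_small kv) -!val_natr -gk; congr val.
  by rewrite mulnC mulrnA natr_Zp.
move=> H; have := divn_eq (k * y) v; rewrite {}H.
set s := _ %/ _ => E.
have s0 : 0 < s.
  rewrite lt0n; apply: contra kk => /eqP s0; rewrite -[kap]add0n -(mul0n v) -s0 -E.
  exact: dvdn_mulr.
have sk : s < k.
  have : s * v < k * v; last by rewrite ltn_pmul2r.
  have : k * y < k * v by rewrite ltn_pmul2l; lia.
  by lia.
have vs : v <= s * v by rewrite leq_pmull.
have vks : s.+1 * v <= k * v by rewrite leq_mul2r sk orbT.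
have y0 : 0 < y.
  by rewrite lt0n; apply/eqP => y0; move: E; rewrite y0 muln0; lia.
by split=> //; [lia|rewrite mulnBr; move: vks; rewrite mulSn; lia].
Qed.

Lemma quotient_exists (k j : nat) : coprime v k -> exists g : Z, (g *+ k = j%:R)%R.
Proof.
move=> cvk; exists (j%:R / k%:R)%R.
by rewrite -(mulr_natr (_ / _)%R) divrK // natr_unit.
Qed.

Lemma quotient_scale (k : nat) (g : Z) j : (g *+ k = j)%R -> (k%:R * g = j)%R.
Proof. by move=> <-; rewrite mulr_natl. Qed.

End Scale.

(** The congruence [rho kap = - v] modulo [k] is solved by a common solution of two congruences,
    modulo [k] and modulo [kap]; [(k - 1) v] stands for [- v]. *)
Lemma residue_exists v k kap : 1 < k -> coprime k kap -> coprime v k ->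
  exists rho M, [/\ 0 < rho, rho < k & k * M = v + rho * kap].
Proof.
move=> k1 ckk cvk.
pose X := chinese k kap (k.-1 * v) 0.
have XV : X = k.-1 * v %[mod k] by rewrite chinese_modl.
have XW : kap %| X by rewrite /dvdn (chinese_modr ckk) mod0n.
pose rho := (X %/ kap) %% k.
have dv : k %| v + rho * kap.
  rewrite /dvdn -modnDmr modnMml divnK // XV modnDmr -mulSn prednK ?modnMr //.
  by lia.
exists rho, ((v + rho * kap) %/ k); split.
- rewrite lt0n; apply/eqP => r0; move: dv; rewrite r0 mul0n addn0 => dv.
  have : k %| gcdn v k by rewrite dvdn_gcd dv dvdnn.
  by rewrite (eqP cvk) dvdn1; lia.
- by rewrite ltn_mod; lia.
- by rewrite mulnC divnK.
Qed.

(** Dividing [nW - 1] instead of [nW] by [k - 1] makes [r] positive. A large [nV] bounds [k nW] by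
    [(k - 1) v] minus a margin, so [m] stays below [v / k] by a margin of about [C]. *)
Lemma wide_parameters v k nV nW nE K C : 2 < k -> k <= nW -> nE < K ->
  nE + nV + nW = v - 1 -> v + k * k * C <= k * nV ->
  exists m r, [/\ 0 < r, nW = k.-1 * m.+1 + r &
    k * (m + r + nE + C) <= v + k * (k + K)].
Proof.
move=> k2 knW nEK tot big.
pose m := (nW - 1) %/ k.-1 - 1; pose r := ((nW - 1) %% k.-1).+1.
have d0 : 0 < k.-1 by lia.
have q1 : 0 < (nW - 1) %/ k.-1 by rewrite divn_gt0 //; lia.
have nWE : nW = k.-1 * m.+1 + r.
  have := divn_eq (nW - 1) k.-1; rewrite /m /r.
  have -> : ((nW - 1) %/ k.-1 - 1).+1 = (nW - 1) %/ k.-1 by lia.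
  by rewrite [k.-1 * _]mulnC; lia.
exists m, r; split=> //.
have rk : r <= k by rewrite /r; have := ltn_pmod (nW - 1) d0; lia.
have kE : k = k.-1.+1 by lia.
have H : k * (k.-1 * m.+1) + k * k * C <= k.-1 * v.
  have : k * nW + k * nV <= k * (v - 1) by rewrite -mulnDr leq_mul2l; lia.
  have : k * (v - 1) <= k * v by rewrite leq_mul2l; lia.
  have : k * v = v + k.-1 * v by rewrite {1}kE mulSn.
  by rewrite nWE mulnDr; lia.
have H2 : k * (m.+1 + C) <= v.
  rewrite -(leq_pmul2l d0); apply: leq_trans H.
  rewrite mulnDr mulnDr mulnCA leq_add2l mulnA leq_mul2r.
  by rewrite [k.-1 * k]mulnC leq_mul2l leq_pred !orbT.
have : k * (r + nE) <= k * (k + K) by rewrite leq_mul2l; lia.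
by move: H2; rewrite !mulnDr mulnS; lia.
Qed.

Lemma coprime_ndvd k kap : 1 < k -> coprime k kap -> ~~ (k %| kap).
Proof.
move=> k1 ck; apply/negP => /gcdn_idPl e.
by move: ck; rewrite /coprime e => /eqP; lia.
Qed.

(** * Realizations by ranges of the multiplicities *)

Section Families.

Variable n : nat.
Notation v := n.+2.
Notation Z := 'I_n.+2.
Hypothesis oddv : odd v.

Lemma halve (x y : Z) : (x *+ 2 = y *+ 2)%R -> x = y.
Proof.
have u : ((2%:R : Z) \is a GRing.unit)%R by rewrite natr_unit // coprimen2.
by rewrite -(mulr_natr x) -(mulr_natr y); apply: mulIr.
Qed.

(** Division by [V] turns [V] into 1, [W] into [g] and 1 into [g - 1] up to sign, as [V] and [W] are
    adjacent. A ladder between two runs suffices for small [nW], and a wide zigzag with [kap = W]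
    serves for large [nW]. *)
Lemma adjacent_realizes V W nV nW nE K : 1 < V -> 0 < W -> coprime V W ->
  W = V.+1 \/ V = W.+1 -> coprime v V -> 0 < nW -> nE < K ->
  nE + nV + nW = v - 1 -> v + V * V * (W + W + 3 + V + K) <= V * nV ->
  V * (V + K + 2) + W <= v -> realizes n nE 1 nV V nW W.
Proof.
move=> V1 W0 cVW VW cvV nW0 nEK tot bigV big.
have [g gV] := quotient_exists W cvV.
have Wv : W < v.
  by apply: leq_trans big; rewrite -[X in X < _]add0n ltn_add2r muln_gt0; lia.
have [y1 y2 y0 yv] := val_quotient V1 Wv (coprime_ndvd V1 cVW) gV.
have uV := natr_unit cvV.
have uE : (V%:R * (g - 1) = 1%:R \/ V%:R * (g - 1) = - 1%:R)%R.
  rewrite mulrBr (quotient_scale gV) mulr1; case: VW => ->; [left|right];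
  by rewrite mulrS; ring.
have path_g : (exists2 p : seq Z, hamiltonian p & forall w, even_weight w ->
    cost w p = (v - 1 - nW - nE) * w 1%R + nW * w g + nE * w (g - 1)%R) ->
    realizes n nE 1 nV V nW W.
  move=> [p hp cp]; apply: (realizes_scale uV uE (x2 := 1%R) (x3 := g)).
  - by left; rewrite mulr1.
  - by left; exact: quotient_scale.
  exists p => // w wo; rewrite cp //.
  have -> : v - 1 - nW - nE = nV by lia.
  by ring.
apply: path_g.
have [small|large] := leqP (V * (nW + nE + 2) + W) v.
  have B1 : nW + nE + 2 <= val g by rewrite -(@leq_pmul2l V); lia.
  have B2 : nW + nE + 2 <= v - val g by rewrite -(@leq_pmul2l V); lia.
  have [|||p [hp cp]] := @double_ladder n (val g) nW nE 1 nW0; try lia.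
  by exists p => // w wo; rewrite cp // natr_Zp.
have VnW : V <= nW.
  have : V * (V + K + 2) < V * (nW + nE + 2) by lia.
  by rewrite ltn_pmul2l; lia.
(* For [V = 2], [bigV] and [large] would make the multiplicities exceed [v - 1] in total. *)
have V2 : 2 < V.
  rewrite ltn_neqAle V1 andbT; apply/eqP => V2; subst V.
  by move: bigV large tot; lia.
have [m [r [r0 nWE fit]]] := wide_parameters V2 VnW nEK tot bigV.
have [rho [M [rho0 rhoV VM]]] := residue_exists V1 cVW cvV.
have fM : m + W + W + r + nE + 2 < M.
  have : V * (m + W + W + r + nE + 3) <= V * M.
    rewrite VM; move: fit.
    have -> : m + r + nE + (W + W + 3 + V + K) =
      m + W + W + r + nE + 3 + (V + K) by lia.
    by rewrite [V * (_ + (V + K))]mulnDr; lia.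
  by rewrite leq_pmul2l; lia.
have [p hp cp] := wide_diagonal V2 gV VM rho0 rhoV cvV oddv r0 fM.
by exists p => // w wo; rewrite cp // -nWE.
Qed.

(* One of [g] and [- g] has an even representative [y], and then [e = y / 2] up
   to sign. *)
Lemma half_ladder k kap (g e : Z) r t : 1 < k -> kap < v -> ~~ (k %| kap) ->
  (g *+ k = kap%:R)%R -> (e *+ 2 = g)%R -> 0 < r ->
  k * (2 * (r + t) + 1) + kap <= v ->
  exists2 p : seq Z, hamiltonian p & forall w, even_weight w ->
    cost w p = (v - 1 - r - t) * w 1%R + r * w g + t * w e.
Proof.
move=> k1 kv kk gk eg r0 fit.
have [y1 y2 y0 yv] := val_quotient k1 kv kk gk.
have [y [yg ye yk ykv]] : exists y : nat, [/\ (y%:R = g \/ y%:R = - g)%R, ~~ odd y,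
    2 * (r + t) + 1 <= y & 2 * (r + t) + 1 <= v - y].
  have B1 : 2 * (r + t) + 1 <= val g by rewrite -(@leq_pmul2l k); lia.
  have B2 : 2 * (r + t) + 1 <= v - val g by rewrite -(@leq_pmul2l k); lia.
  have gz : ((val g)%:R = g)%R by exact: natr_Zp.
  case: (boolP (odd (val g))) => og.
    exists (v - val g); split; [right|by lia|done|by lia].
    by rewrite natr_sub ?gz //; lia.
  by exists (val g); split; [left|done|done|done].
have yE : y = y./2 + y./2 by rewrite addnn -[LHS]odd_double_half (negbTE ye).
have [|||p [hp cp]] := @double_ladder n y r t y./2 r0; try lia.
exists p => // w wo; rewrite cp //.
have -> : w (y%:R)%R = w g by case: yg => ->; rewrite ?wo.
suff -> : w (y%:R - (y./2)%:R)%R = w e by [].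
have -> : (y%:R - (y./2)%:R = (y./2)%:R :> Z)%R.
  by rewrite {1}yE natrD addrK.
have : ((y./2)%:R = e \/ (y./2)%:R = - e :> Z)%R.
  have H : ((y./2)%:R *+ 2 = y%:R :> Z)%R by rewrite mulr2n -natrD -yE.
  case: yg => yg; [left|right]; apply: halve; rewrite H yg -eg //.
  by rewrite mulNrn.
by case=> ->; rewrite ?wo.
Qed.

(** Division by [x] turns [x] into 1, 2 into [g] and 1 into [e = g / 2]. The number [b] of steps [g]
    decides between [half_ladder] and [wide_half]. *)
Lemma odd_step_realizes x a b c K :
  odd x -> 4 < x -> coprime v x -> 0 < b -> a < K ->
  a + c + b = v - 1 -> v + x * x * (7 + x + K) <= x * c ->
  x * (2 * (x + K) + 1) + 2 <= v -> realizes n a 1 c x b 2.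
Proof.
move=> ox x4 cvx b0 aK tot bigc big.
have x1 : 1 < x by lia.
have x2 : 2 < x by lia.
have c2 : coprime x 2 by rewrite coprimen2.
have [g gx] := quotient_exists 2 cvx.
have [e ex] := quotient_exists 1 cvx.
have eg : (e *+ 2 = g)%R.
  have ux := natr_unit cvx.
  apply: (mulrI ux); rewrite mulrnAr (quotient_scale gx) (quotient_scale ex).
  by rewrite -mulrnA mul1n.
have conv : (exists2 p : seq Z, hamiltonian p & forall w, even_weight w ->
    cost w p = (v - 1 - b - a) * w 1%R + b * w g + a * w e) ->
    realizes n a 1 c x b 2.
  move=> [p hp cp].
  apply: (realizes_scale (natr_unit cvx) (x1 := e) (x2 := 1%R) (x3 := g)).
  - by left; exact: quotient_scale.
  - by left; rewrite mulr1.
  - by left; exact: quotient_scale.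
  exists p => // w wo; rewrite cp //.
  have -> : v - 1 - b - a = c by lia.
  by ring.
apply: conv.
have [small|large] := leqP (x * (2 * (b + a) + 1) + 2) v.
  by apply: half_ladder gx eg b0 small => //; [lia|exact: coprime_ndvd].
have xb : x <= b.
  have : x * (2 * (x + K) + 1) < x * (2 * (b + a) + 1) by lia.
  by rewrite ltn_pmul2l; lia.
have [m [r [r0 bE fit]]] := wide_parameters x2 xb aK tot bigc.
have [rho [M [rho0 rhox xM]]] := residue_exists x1 c2 cvx.
have fM : m + 2 + 2 + r + a + 2 < M.
  have : x * (m + 2 + 2 + r + a + 3) <= x * M.
    rewrite xM; move: fit.
    have -> : m + r + a + (7 + x + K) = m + 2 + 2 + r + a + 3 + (x + K) by lia.
    by rewrite [x * (_ + (x + K))]mulnDr; lia.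
  by rewrite leq_pmul2l; lia.
have [p hp cp] := wide_half x2 gx xM rho0 rhox cvx oddv r0 fM ox x4 (erefl 2) eg.
by exists p => // w wo; rewrite cp // -bE.
Qed.

(** Division by 2 turns 2 into 1, [x] into [g] and 1 into [g - (x - 1) / 2], so the later rungs of
    the ladder are shifted by [x./2]. *)
Lemma odd_double_realizes x a b c : odd x -> coprime v x -> 0 < c ->
  a + b + c = v - 1 -> 2 * (c + x + a + 1) + x <= v ->
  realizes n a 1 b 2 c x.
Proof.
move=> ox cvx c0 tot fit.
have cv2 : coprime v 2 by rewrite coprimen2.
have [g g2] := quotient_exists x cv2.
have xv : x < v by lia.
have nd : ~~ (2 %| x) by rewrite dvdn2 ox.
have [y1 y2 y0 yv] := val_quotient (isT : 1 < 2) xv nd g2.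
have [|||p [hp cp]] := @double_ladder n (val g) c a x./2 c0; try lia.
have xE : x = (x./2 + x./2).+1 by rewrite addnn -[LHS]odd_double_half ox.
apply: (realizes_scale (natr_unit cv2)
  (x1 := (g - (x./2)%:R)%R) (x2 := 1%R) (x3 := g)).
- left; rewrite mulrBr (quotient_scale g2) {1}xE -natr1 natrD; ring.
- by left; rewrite mulr1.
- by left; exact: quotient_scale.
exists p => // w wo; rewrite cp // natr_Zp.
have -> : v - 1 - c - a = b by lia.
by ring.
Qed.

Lemma two_realizes a b : 0 < a -> a + b = v - 1 -> 2 * a + 1 <= v ->
  realizes n a 1 b 2 0 2.
Proof.
move=> a0 tot fit.
have cv2 : coprime v 2 by rewrite coprimen2.
have [g g2] := quotient_exists 1 cv2.
have [y1 y2 y0 yv] := val_quotient (isT : 1 < 2) (isT : 1 < v) isT g2.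
have [||X [W [hp cp]]] := @single_ladder n (val g) a y0 yv a0; try lia.
move: hp cp; set p := (X in hamiltonian X) => hp cp.
apply: (realizes_scale (natr_unit cv2) (x1 := g) (x2 := 1%R) (x3 := 1%R)).
- by left; exact: quotient_scale.
- by left; rewrite mulr1.
- by left; rewrite mulr1.
exists p => // w wo; rewrite cp // natr_Zp.
have -> : v - 1 - a = b by lia.
by ring.
Qed.

(** Division by [2 z] turns 2 into [g = 1 / z] and 1 into half of it. This serves when only the
    length [2 z] is frequent. *)
Lemma even_step_realizes z a b c : 1 < z -> coprime v z -> 0 < b ->
  a + b + c = v - 1 -> z * (2 * (b + a) + 1) + 1 <= v ->
  realizes n a 1 b 2 c (2 * z).
Proof.
move=> z1 cvz b0 tot fit.
have cv2 : coprime v 2 by rewrite coprimen2.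
have cvx : coprime v (2 * z) by rewrite coprimeMr cv2.
have [g gz] := quotient_exists 1 cvz.
have [e ex] := quotient_exists 1 cvx.
have eg : (e *+ 2 = g)%R.
  apply: (mulrI (natr_unit cvz)); rewrite (quotient_scale gz) -ex mulr_natl.
  by rewrite -mulrnA.
have nd : ~~ (z %| 1) by rewrite dvdn1; lia.
have [p hp cp] := half_ladder z1 (isT : 1 < v) nd gz eg b0 fit.
apply: (realizes_scale (natr_unit cvx) (x1 := e) (x2 := g) (x3 := 1%R)).
- by left; exact: quotient_scale.
- by left; rewrite natrM -mulrA (quotient_scale gz) mulr1.
- by left; rewrite mulr1.
exists p => // w wo; rewrite cp //.
have -> : v - 1 - b - a = c by lia.
by ring.
Qed.

(** Division by 2 turns [2 z] into the integer [z], whose steps fit into a standard path, while 1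
    becomes [g = 1 / 2] and supplies the rungs. *)
Lemma even_double_realizes z a b c : 0 < z -> 0 < a ->
  a + b + c = v - 1 -> 2 * (c + z * z.-1 + a) + 1 <= v ->
  realizes n a 1 b 2 c (2 * z).
Proof.
move=> z0 a0 tot fit.
have cv2 : coprime v 2 by rewrite coprimen2.
have [g g2] := quotient_exists 1 cv2.
have [y1 y2 y0 yv] := val_quotient (isT : 1 < 2) (isT : 1 < v) isT g2.
have [||p hp cp] := @single_ladder_standard n (val g) a z c z0 y0 yv a0; try lia.
apply: (realizes_scale (natr_unit cv2) (x1 := g) (x2 := 1%R) (x3 := (z%:R)%R)).
- by left; exact: quotient_scale.
- by left; rewrite mulr1.
- by left; rewrite natrM.
exists p => // w wo; rewrite cp // natr_Zp.
have -> : v - 1 - a - c = b by lia.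
by ring.
Qed.

(** Division by 2 turns 1 into [h = 1 / 2]. The doubled path already has one step [h], so
    [t = a - 1] rotations remain; [q] comes from a quotient rounded up, and [rho] removes the excess
    steps [z]. *)
Lemma doubled_realizes z a b c K : 1 < z -> 0 < a -> a < K ->
  a + b + c = v - 1 -> 4 * z <= b -> 2 * z * (2 * z + K) + 2 <= c ->
  realizes n a 1 b 2 c (2 * z).
Proof.
move=> z1 a0 aK tot bb cc.
have cv2 : coprime v 2 by rewrite coprimen2.
pose t := a.-1; pose q := (c + t - 2 + (2 * z).-1) %/ (2 * z).
pose l := v./2.
have vl : v = l + l + 1 by rewrite addnn addn1 -add1n -[LHS]odd_double_half oddv.
have d0 : 0 < 2 * z by lia.
have q1 : 2 * z * q <= c + t - 2 + (2 * z).-1 by rewrite mulnC leq_divM.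
have q2 : c + t - 2 <= 2 * z * q.
  have := ltn_ceil (c + t - 2 + (2 * z).-1) d0.
  by rewrite -/q (mulSn q) (mulnC q); lia.
pose rho := 2 + 2 * z * q - (c + t).
have ql : z * q.+1 < l by rewrite mulnS; move: q1; rewrite -mulnA; lia.
have qb : 2 * z + K <= q.
  rewrite -(@leq_pmul2l (2 * z)) //; lia.
have rtq : rho + t < q.+1 by rewrite /rho; lia.
have [p hp cp] := doubled_path z1 vl ql rtq.
apply: (realizes_scale (natr_unit cv2)
  (x1 := (l.+1%:R)%R) (x2 := 1%R) (x3 := (z%:R)%R)).
- left; rewrite -natrM; have -> : 2 * l.+1 = v + 1 by lia.
  by rewrite natrD natr_mod add0r.
- by left; rewrite mulr1.
- by left; rewrite natrM.
exists p => // w wo; rewrite cp //=.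
have -> : t.+1 = a by rewrite /t; lia.
have -> : 2 + 2 * z * q - rho - t = c by rewrite /rho; lia.
have -> : 2 * (l - z * q.+1) + 2 * z - 3 + rho = b.
  by move: ql; rewrite /rho mulnS -mulnA; lia.
by ring.
Qed.

End Families.

(** * Case distinctions for large [v] *)

Lemma consecutive_realizes x : 1 < x -> exists N, forall n, N <= n.+2 ->
  odd n.+2 -> coprime n.+2 x -> coprime n.+2 x.+1 ->
  forall a b c, 0 < a -> 0 < b -> 0 < c -> a + b + c = n.+2 - 1 ->
  realizes n a 1 b x c x.+1.
Proof.
move=> x1.
pose K := x * x.-1 + x.+1 * x + 1.
pose C1 := x * x * (x.+1 + x.+1 + 3 + x + K).
pose C2 := x.+1 * x.+1 * (x + x + 3 + x.+1 + K).
pose S := x + x * K + C1.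
pose N0 := x.+1 * S + x * C2.
pose N1 := x * (x + K + 2) + x.+1.
pose N2 := x.+1 * (x.+1 + K + 2) + x.
exists (N0 + N1 + N2) => n; set v := n.+2 => vN oddv cx cx1 a b c a0 b0 c0 tot.
have [Ka|aK] := leqP K a.
  have x0 : 0 < x by lia.
  have [||p hp cp] := @linear_path n x x.+1 a b c x0 _ _ tot => //.
    by move: Ka; rewrite /K /=; lia.
  by exists p.
have [big|small] := leqP (v + C1) (x * b).
  by apply: (adjacent_realizes oddv x1 _ (coprimenS x)) big _; rewrite -/v; lia.
(* [x b < v + C1] leaves about [(1 - 1 / x) v] for [c]. Since [(x + 1) (x - 1) >= x + 1], the
   product [x (x + 1) c] exceeds [x v] by at least about [v], which absorbs the constants. *)
suff big : v + C2 <= x.+1 * c.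
  have [q hq cq] : realizes n a 1 c x.+1 b x.
    apply: (adjacent_realizes oddv _ _ (coprimeSn x)) big _; rewrite -/v; lia.
  by exists q => // w wo; rewrite cq // addnAC.
rewrite -(@leq_pmul2l x); last by lia.
have e1 : x * c + x * b + x * a + x = x * v.
  have -> : v = a + b + c + 1 by lia.
  by rewrite !mulnDr muln1; lia.
have e2 : x * a <= x * K by rewrite leq_mul2l ltnW ?orbT.
have e3 : x * v <= x * c + v + S by rewrite /S; lia.
have e4 : x.+1 * (x * v) <= x.+1 * (x * c) + x.+1 * v + x.+1 * S.
  by rewrite -!mulnDr leq_mul2l e3 orbT.
have e5 : x.+2 * v <= x * (x * v).
  have xx : x.+2 <= x * x.
    by apply: leq_trans (_ : 2 * x <= _); rewrite ?leq_mul2r ?x1 ?orbT //; lia.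
  by rewrite mulnA leq_mul2r xx orbT.
have e6 : x.+1 * S + x * C2 <= v by rewrite -/N0; lia.
rewrite mulnDr mulnCA; move: e4 e5; rewrite !mulSn; lia.
Qed.

(** When [a] is below [K], an odd [x] is divided out if [c] is large, and 2 otherwise. For even
    [x = 2 z], bounded [b] or bounded [c] makes the other one frequent, and doubled paths serve when
    both are large. *)
Lemma doubling_realizes x : 3 < x -> exists N, forall n, N <= n.+2 ->
  odd n.+2 -> coprime n.+2 x ->
  forall a b c, 0 < a -> 0 < b -> 0 < c -> a + b + c = n.+2 - 1 ->
  realizes n a 1 b 2 c x.
Proof.
move=> x3.
pose K := 2 + x * x.-1 + 1.
have lin n a b c : K <= a -> a + b + c = n.+2 - 1 -> realizes n a 1 b 2 c x.
  move=> Ka tot; have x0 : 0 < x by lia.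
  have [|p hp cp] := @linear_path n 2 x a b c isT x0 _ tot.
    by move: Ka; rewrite /K /=; lia.
  by exists p.
case ox : (odd x).
  pose C := x * x * (7 + x + K).
  pose N0 := 2 * C + x * (2 * (x + K + 1) + x).
  pose N1 := x * (2 * (x + K) + 1) + 2.
  exists (N0 + N1) => n; set v := n.+2 => vN oddv cx a b c a0 b0 c0 tot.
  have [Ka|aK] := leqP K a; first exact: lin.
  have x4 : 4 < x by rewrite ltn_neqAle x3 andbT; apply/eqP => e; move: ox; rewrite -e.
  have [big|small] := leqP (v + C) (x * c).
    have tot' : a + c + b = v - 1 by lia.
    have [|q hq cq] := odd_step_realizes oddv ox x4 cx b0 aK tot' big.
      by move: vN; rewrite -/v /N1; lia.
    by exists q => // w wo; rewrite cq // addnAC.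
  apply: (odd_double_realizes oddv ox cx c0 tot).
  rewrite -(@leq_pmul2l x) -/v; last by lia.
  (* With [x >= 5], the bound [x c < v + C] keeps [2 c] well below [v]. *)
  have e1 : 5 * v <= x * v by rewrite leq_mul2r x4 orbT.
  have e2 : x * (2 * (x + a + 1) + x) <= x * (2 * (x + K + 1) + x).
    by rewrite leq_mul2l; apply/orP; right; lia.
  have -> : 2 * (c + x + a + 1) + x = c + c + (2 * (x + a + 1) + x) by lia.
  rewrite (mulnDr x (c + c)) (mulnDr x c).
  by move: vN e1 e2 small; rewrite /N0; lia.
pose z := x./2.
have xE : x = 2 * z by rewrite mul2n -[LHS]odd_double_half ox.
pose D := 2 * z * (2 * z + K) + 2.
exists (z * (2 * (4 * z + K) + 1) + 1 + 2 * (D + z * z.-1 + K) + 1).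
move=> n; set v := n.+2 => vN oddv cx a b c a0 b0 c0 tot.
have [Ka|aK] := leqP K a; first exact: lin.
have z1 : 1 < z by lia.
have cz : coprime v z by move: cx; rewrite xE coprimeMr => /andP [].
rewrite xE.
have [bb|bs] := leqP (4 * z) b; last first.
  apply: even_step_realizes => //.
  have : z * (2 * (b + a) + 1) <= z * (2 * (4 * z + K) + 1).
    by rewrite leq_mul2l; apply/orP; right; lia.
  by rewrite -/v; lia.
have [cc|cs] := leqP D c; last first.
  by apply: even_double_realizes => //; rewrite -/v; lia.
exact: doubled_realizes aK tot bb cc.
Qed.

Lemma two_step_realizes n a b : odd n.+2 -> 6 <= n.+2 -> 0 < a ->
  a + b = n.+2 - 1 -> realizes n a 1 b 2 0 2.
Proof.
move=> oddv v6 a0 tot.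
have [aK|Ka] := leqP a 2; first by apply: two_realizes => //; lia.
have tot' : a + b + 0 = n.+2 - 1 by lia.
have [|p hp cp] := @linear_path n 2 1 a b 0 isT isT _ tot' => //.
by exists p => // w wo; rewrite cp.
Qed.

(** * Back to multisets of lengths *)

Section Realization.

Variable n : nat.
Notation v := n.+2.
Notation Z := 'I_n.+2.

Definition residue_length (z : Z) := minn z (v - z).

Lemma cyclic_length_sub (x y : Z) : cyclic_length x y = residue_length (x - y)%R.
Proof.
have xv := ltn_ord x; have yv := ltn_ord y.
rewrite /cyclic_length /residue_length.
have [lt|ge] := ltnP x y.
  have -> : val (x - y)%R = x + v - y.
    by rewrite /= modnDmr modn_small; lia.
  lia.
have -> : val (x - y)%R = x - y.
  rewrite /= modnDmr; have -> : x + (v - y) = x - y + v by lia.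
  by rewrite modnDr modn_small //; lia.
lia.
Qed.

Lemma residue_length_opp z : residue_length (- z)%R = residue_length z.
Proof.
have zv := ltn_ord z; rewrite /residue_length /=.
case: (posnP z) => [->|z0]; first by rewrite !subn0 modnn !min0n.
by rewrite modn_small; lia.
Qed.

Lemma residue_length_nat j : 2 * j <= v -> residue_length (j%:R)%R = j.
Proof. by move=> jv; rewrite /residue_length val_natr modn_small; lia. Qed.

(** Indicator weights of single lengths turn cost identities for all even weights into an equality
    of multisets. *)
Lemma count_edge_lengths (q : seq Z) i :
  edge_lengths q i = cost (fun z => residue_length z == i) q.
Proof.
rewrite /edge_lengths mset_seqE /path_edges; elim: q => // x [|y q] IH //.
by rewrite cost_cons -IH /= cyclic_length_sub.
Qed.

Lemma realization_exists a l1 b l2 c l3 (L : {mset nat}) :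
  realizes n a l1 b l2 c l3 -> 2 * l1 <= v -> 2 * l2 <= v -> 2 * l3 <= v ->
  (forall i, L i = a * (l1 == i) + b * (l2 == i) + c * (l3 == i)) ->
  exists p : seq 'I_v, is_realization L p.
Proof.
move=> [q hq cq] h1 h2 h3 Li; exists q; split; last first.
  apply/msetP => i; rewrite count_edge_lengths cq ?Li ?residue_length_nat //.
  by move=> z; rewrite residue_length_opp.
have uq : uniq q.
  rewrite (perm_uniq hq) runE map_inj_in_uniq ?iota_uniq // => j k.
  rewrite !mem_iota !add0r /= => jv kv /(congr1 val).
  by rewrite !val_natr !modn_small.
apply/and3P; split=> //; last by apply/forallP => x; exact: mem_hamiltonian.
by move: uq; rewrite uniq_pairwise; exact: pairwise_sorted.
Qed.

End Realization.

Lemma mset_supp3 (L : {mset nat}) y z : 1 < y -> 1 < z -> y != z ->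
  finsupp L = [fset 1; y; z] ->
  [/\ 0 < L 1, 0 < L y, 0 < L z, size L = L 1 + L y + L z &
   forall i, L i = L 1 * (1 == i) + L y * (y == i) + L z * (z == i)].
Proof.
move=> y1 z1 yz sL.
have pos i : (0 < L i) = (i \in [fset 1; y; z]) by rewrite -sL mem_finsupp lt0n.
have Li i : L i = L 1 * (1 == i) + L y * (y == i) + L z * (z == i).
  have := pos i; rewrite !inE.
  case: (eqVneq i 1) => [->|i1]; first by rewrite (gtn_eqF y1) (gtn_eqF z1); lia.
  case: (eqVneq i y) => [->|iy]; first by rewrite (eq_sym z) (negbTE yz); lia.
  by case: (eqVneq i z) => [->|iz] /=; lia.
split=> //; try by rewrite pos !inE eqxx ?orbT.
rewrite -sum1_size sum_mset sL (perm_big [:: 1; y; z]) /=.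
  by rewrite !big_cons big_nil !muln1 addn0 addnA.
apply: uniq_perm; [exact: fset_uniq| |by move=> i; rewrite !inE orbA].
by rewrite /= !inE negb_or yz !andbT; apply/andP; split; rewrite ltn_eqF.
Qed.

Lemma mset_supp2 (L : {mset nat}) : finsupp L = [fset 1; 2; 2] ->
  [/\ 0 < L 1, size L = L 1 + L 2 &
   forall i, L i = L 1 * (1 == i) + L 2 * (2 == i) + 0 * (2 == i)].
Proof.
move=> sL.
have pos i : (0 < L i) = (i \in [fset 1; 2; 2]) by rewrite -sL mem_finsupp lt0n.
split; first by rewrite pos !inE.
  rewrite -sum1_size sum_mset sL (perm_big [:: 1; 2]) /=.
    by rewrite !big_cons big_nil !muln1 addn0.
  by apply: uniq_perm; [exact: fset_uniq|done|move=> i; rewrite !inE -orbA orbb].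
move=> i; have := pos i; rewrite !inE.
by case: i => [|[|[|i]]] /=; lia.
Qed.

Lemma odd_of_coprime v x : gcdn v x = 1 -> gcdn v (x + 1) = 1 -> odd v.
Proof.
move=> gx gx1; rewrite -[odd v]negbK -dvdn2; apply/negP => v2.
case ox : (odd x).
  have : 2 %| gcdn v (x + 1) by rewrite dvdn_gcd v2 dvdn2 oddD ox.
  by rewrite gx1.
have : 2 %| gcdn v x by rewrite dvdn_gcd v2 dvdn2 ox.
by rewrite gx.
Qed.

Lemma divisor_condition v x (L : {mset nat}) : 0 < v -> gcdn v x = 1 ->
  gcdn v (x + 1) = 1 -> size L = v - 1 ->
  finsupp L = [fset 1; 2; x] \/ finsupp L = [fset 1; x; x + 1] ->
  forall d, d %| v -> count (fun l => d %| l) L <= v - d.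
Proof.
move=> v0 gx gx1 sizeL sL d dv.
have dpos : 0 < d by exact: dvdn_gt0 dv.
case: (eqVneq d 1) => [->|d1]; first by rewrite -sizeL count_size.
have coprime_dvd l : gcdn v l = 1 -> ~~ (d %| l).
  by move=> g1; apply: contra d1 => dl; rewrite -dvdn1 -g1 dvdn_gcd dv.
have ov : odd v by exact: odd_of_coprime gx gx1.
have g2 : gcdn v 2 = 1 by apply/eqP; rewrite -/(coprime v 2) coprimen2.
rewrite (_ : count _ _ = 0) //; apply/eqP; rewrite eqn0Ngt -has_count -all_predC.
apply/allP => l; rewrite -msuppE.
by case: sL => -> ; rewrite !inE -orbA => /or3P [] /eqP -> /=;
   apply: coprime_dvd; rewrite // gcdn1.
Qed.

Theorem theorem1p4 (x : nat) (hx : 1 < x) :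
  exists N : nat, forall v : nat,
    N <= v -> gcdn v x = 1 -> gcdn v (x + 1) = 1 ->
    forall L : {mset nat},
      size L = v - 1 ->
      finsupp L = [fset 1; 2; x] \/ finsupp L = [fset 1; x; x + 1] ->
      ~ (finsupp L = [fset 1; 2; x] /\ odd x /\ L 1 < 3) ->
      (exists p : seq 'I_v, is_realization L p) <->
      (forall d : nat, d %| v -> count (fun l => d %| l) L <= v - d).
Proof.
have [N1 H1] := consecutive_realizes hx.
(* The support [{1, 2, 3}] is treated as consecutive lengths 2 and 3. *)
have [N2 H2] := consecutive_realizes (isT : 1 < 2).
have [N3 H3] : exists N, 3 < x -> forall n, N <= n.+2 ->
    odd n.+2 -> coprime n.+2 x ->
    forall a b c, 0 < a -> 0 < b -> 0 < c -> a + b + c = n.+2 - 1 ->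
    realizes n a 1 b 2 c x.
  case: (ltnP 3 x) => [/doubling_realizes [N HN]|_]; last by exists 0.
  by exists N.
(* The summand [2 * x + 6] keeps every length at most [v / 2]. *)
exists (N1 + N2 + N3 + 2 * x + 6) => v vN gx gx1 L sizeL supp _.
split=> [_|_]; first by apply: divisor_condition gx gx1 sizeL supp; lia.
have ov := odd_of_coprime gx gx1.
case: v vN gx gx1 ov sizeL => [|[|n]] vN gx gx1 ov sizeL; [lia|lia|].
have cx : coprime n.+2 x by apply/eqP.
have cx1 : coprime n.+2 x.+1 by rewrite -(addn1 x); apply/eqP.
have x1 : 1 < x + 1 by lia.
have xx : x != x + 1 by lia.
case: supp => supp; last first.
  have [a0 b0 c0 sL Li] := mset_supp3 hx x1 xx supp.
  apply: (realization_exists _ _ _ _ Li); rewrite ?addn1; try lia.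
  by apply: H1 => //; rewrite ?addn1 in c0 sL *; lia.
(* Here the support degenerates to [{1, 2}]. *)
have [x2|x2] := eqVneq x 2.
  subst x; have [a0 sL Li] := mset_supp2 supp.
  apply: (realization_exists _ _ _ _ Li); try lia.
  by apply: two_step_realizes => //; lia.
have x2' : 2 != x by rewrite eq_sym.
have [a0 b0 c0 sL Li] := mset_supp3 (isT : 1 < 2) hx x2' supp.
apply: (realization_exists _ _ _ _ Li); try lia.
have [x3|x3] := eqVneq x 3; last by apply: H3 => //; lia.
subst x; apply: H2 => //; try lia.
by rewrite coprimen2.
Qed.
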